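(* Let $y_1,\dots,y_k\ge0$ with $\sum_i y_i=1$, and let $w\in S_n$ be distributed as the generalized shuffling method on $C_n$ with parameters $y_1,\dots,y_k$ after forgetting signs. Let $Q$ be a standard Young tableau of shape $\lambda\vdash n$. Then the probability that the (usual) RSK correspondence associates recording tableau $Q$ to $w$ is $\frac{1}{2^n}S_\lambda(y_1,\dots,y_k)$. Consequently the probability that $w$ has RSK shape $\lambda$ is $\frac{f_\lambda}{2^n}S_\lambda(y_1,\dots,y_k)$, where $f_\lambda$ is the number of standard Young tableaux of shape $\lambda$.
   Context: Generalized shuffling method on $C_n$ with parameters $y_1,\dots,y_k$: start with $n$ cards face down; choose $j_1,\dots,j_{2k}$ with probability $\binom{n}{j_1,\dots,j_{2k}}\prod_{i=1}^k y_i^{j_{2i-1}+j_{2i}}$; cut the deck into $2k$ consecutive stacks of sizes $j_1,\dots,j_{2k}$; flip over the even-numbered stacks; then choose uniformly one of the $\binom{n}{j_1,\dots,j_{2k}}$ interleavings. Forgetting signs gives $w\in S_n$; concretely $w$ has the law of: a word $J$ of length $n$ on $\{\pm1,\dots,\pm k\}$ with independent letters, $\pm i$ each with probability $y_i/2$; using the order $1<-1<2<\cdots<k<-k$, consecutive blocks of $1,\dots,n$ are assigned to letter values in that order, placed at the positions of a positive letter in increasing order left to right and at the positions of a negative letter in decreasing order left to right; $w(p)$ is the integer at position $p$. The RSK recording tableau of $w$ is obtained by row-inserting $w(1),\dots,w(n)$. $S_\lambda(y)=\det(q_{\lambda_i-i+j})$, where $q_{-r}=0$ for $r>0$ and $\sum_{r\ge0}q_rt^r=\prod_{i}\frac{1+y_it}{1-y_it}$.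 *)

(* Defs.v *)
From HB Require Import structures.
From mathcomp Require Import all_boot all_order all_algebra all_fingroup.
Set Implicit Arguments. Unset Strict Implicit. Unset Printing Implicit Defensive.
Import Order.TTheory GRing.Theory Num.Theory.

Definition is_part (lam : seq nat) : bool :=
  sorted geq lam && all (fun a => 0 < a) lam.

(* a tableau is a list of rows (top row first) *)
Definition tab_shape (T : seq (seq nat)) : seq nat := map size T.

Definition is_SYT (lam : seq nat) (T : seq (seq nat)) : bool :=
  [&& tab_shape T == lam,
      all (sorted ltn) T,
      all (fun i => all (fun j => nth 0 (nth [::] T i) j < nth 0 (nth [::] T i.+1) j)
                        (iota 0 (size (nth [::] T i.+1))))
          (iota 0 (size T)) &
      perm_eq (flatten T) (iota 1 (sumn lam))].

(* number of standard Young tableaux of shape lam: every SYT of shape lam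
   is obtained in exactly one way by filling the cells of lam in row
   reading order with a permutation of 1..n *)
Definition nSYT (lam : seq nat) : nat :=
  let n := sumn lam in
  #|[set s : 'S_n | is_SYT lam (reshape lam [seq (s i).+1 | i <- enum 'I_n])]|.

Fixpoint rinsert (P : seq (seq nat)) (x : nat) : seq (seq nat) * nat :=
  match P with
  | [::] => ([:: [:: x]], 0)
  | r :: P' =>
      if has (fun z => x < z) r then
        let i := find (fun z => x < z) r in
        let y := nth 0 r i in
        let res := rinsert P' y in
        (set_nth 0 r i x :: res.1, res.2.+1)
      else (rcons r x :: P', 0)
  end.

Definition addcell (Q : seq (seq nat)) (j t : nat) : seq (seq nat) :=
  if j < size Q then set_nth [::] Q j (rcons (nth [::] Q j) t)
  else rcons Q [:: t].

Definition RSK (w : seq nat) : seq (seq nat) * seq (seq nat) :=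
  foldl (fun PQ (tx : nat * nat) =>
           let res := rinsert PQ.1 tx.2 in
           (res.1, addcell PQ.2 res.2 tx.1))
        ([::], [::]) (zip (iota 1 (size w)) w).

Definition RSK_rec (w : seq nat) : seq (seq nat) := (RSK w).2.

(* a letter (i, b) denotes +(i+1) if b = false and -(i+1) if b = true *)
Definition letter k := ('I_k * bool)%type.

(* position of a letter in the order 1 < -1 < 2 < -2 < ... < k < -k *)
Definition lkey k (a : letter k) : nat := (2 * a.1 + a.2)%N.

(* the permutation w (one-line notation w(1)..w(n), values 1..n) attached
   to the word J: consecutive blocks of 1..n are assigned to letter values
   in the above order, placed increasingly left to right at positions of a
   positive letter, decreasingly at positions of a negative letter *)
Definition shuffle_perm k n (J : n.-tuple (letter k)) : seq nat :=
  [seq (#|[set q : 'I_n | lkey (tnth J q) < lkey (tnth J p)]|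
        + (if (tnth J p).2
           then #|[set q : 'I_n | (p <= q)%N && (tnth J q == tnth J p)]|
           else #|[set q : 'I_n | (q <= p)%N && (tnth J q == tnth J p)]|))%N
  | p <- enum 'I_n].

Local Open Scope ring_scope.

(* probability of the word J: independent letters, +-i each w.p. y_i/2 *)
Definition word_prob (R : fieldType) k n (y : 'I_k -> R)
  (J : n.-tuple (letter k)) : R :=
  \prod_(p < n) (y (tnth J p).1 / 2).

(* q_r = coefficient of t^r in prod_i (1 + y_i t)/(1 - y_i t); the
   geometric series is truncated at degree r, which does not affect the
   coefficient of t^r *)
Definition qcoef (R : fieldType) k (y : 'I_k -> R) (r : nat) : R :=
  (\prod_(i < k) ((1 + y i *: 'X) * \sum_(m < r.+1) (y i *: 'X) ^+ m))`_r.

Definition qcoefz (R : fieldType) k (y : 'I_k -> R) (z : int) : R :=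
  match z with Posz r => qcoef y r | Negz _ => 0 end.

Definition Slam (R : fieldType) k (y : 'I_k -> R) (lam : seq nat) : R :=
  let l := size lam in
  \det (\matrix_(i < l, j < l)
          qcoefz y ((nth 0 lam i)%:Z - i%:Z + j%:Z)).

(* Main.v *)
Require Import Defs.
From mathcomp Require Import all_boot all_order all_algebra all_fingroup.
From mathcomp Require Import zify ring.
Import Order.TTheory GRing.Theory Num.Theory.
Set Implicit Arguments.
Unset Strict Implicit.
Unset Printing Implicit Defensive.

(** Code the letters 1 < -1 < 2 < -2 < ... by 0, 1, 2, 3, ..., so that positive
letters are even.  Row insertion of [w] is the standardization of an insertion
of the word [J] itself, in which an even letter bumps strictly larger letters
and an odd letter bumps larger or equal ones.  Reverse insertion shows that, for
a fixed recording tableau of shape [lam], words correspond bijectively and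
content-preservingly to tableaux of shape [lam] whose even letters form
horizontal strips and whose odd letters form vertical strips.  The weighted
count of these tableaux satisfies a recursion on the number of letters, and the
determinant satisfies the same one: a factor [1 + z t] expands the rows into
vertical strips, since non-strip choices give equal or zero rows, and a factor
[1/(1 - z t)] expands them into horizontal strips after subtracting from each
row a multiple of the next one. *)

(** * Insertion for a general bumping relation *)

Section Insertion.
Variable lt : rel nat.

(** When nothing is bumped, [find] returns the size of the row and [set_nth] appends, so one formula
    covers bumping and appending. *)
Definition rins (r : seq nat) (x : nat) : seq nat :=
  set_nth 0 r (find (lt x) r) x.

Fixpoint ins (P : seq (seq nat)) (x : nat) : seq (seq nat) * nat :=
  match P with
  | [::] => ([:: [:: x]], 0)
  | r :: P' =>
      if has (lt x) r then
        let res := ins P' (nth 0 r (find (lt x) r)) in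
        (rins r x :: res.1, res.2.+1)
      else (rcons r x :: P', 0)
  end.

(** Stated through [lt] alone: a letter [a] with [lt a a] may not repeat in a row but may repeat
    down a column, and the other letters behave the opposite way. *)
Definition rowok (r : seq nat) : Prop :=
  forall i j, i < j -> j < size r -> ~~ lt (nth 0 r j) (nth 0 r i).

Definition colok (r s : seq nat) : Prop :=
  size s <= size r /\ forall j, j < size s -> lt (nth 0 r j) (nth 0 s j).

Fixpoint tabok (T : seq (seq nat)) : Prop :=
  match T with
  | [::] => True
  | r :: T' => [/\ rowok r, colok r (head [::] T') & tabok T']
  end.

Lemma nth_rins r x j :
  nth 0 (rins r x) j = if j == find (lt x) r then x else nth 0 r j.
Proof. by rewrite /rins nth_set_nth. Qed.

Lemma size_rins r x : size (rins r x) = maxn (find (lt x) r).+1 (size r).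
Proof. by rewrite /rins size_set_nth. Qed.

Lemma rins_rcons r x : ~~ has (lt x) r -> rins r x = rcons r x.
Proof.
move=> h; rewrite /rins hasNfind //.
elim: {h}r => //= a r IH; by rewrite -IH.
Qed.

Lemma find_has r x : has (lt x) r -> find (lt x) r < size r.
Proof. by rewrite has_find. Qed.

Lemma lt_find r x : has (lt x) r -> lt x (nth 0 r (find (lt x) r)).
Proof. exact: nth_find. Qed.

Lemma nlt_find r x j : j < find (lt x) r -> ~~ lt x (nth 0 r j).
Proof. by move=> h; rewrite (before_find 0 h). Qed.

Lemma head_ins P x : head [::] (ins P x).1 = rins (head [::] P) x.
Proof. by case: P => //= r P; case: ifPn => //= h; rewrite rins_rcons. Qed.

Lemma tabok_nth T : tabok T <->
  forall i, i < size T ->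
    rowok (nth [::] T i) /\ colok (nth [::] T i) (nth [::] T i.+1).
Proof.
elim: T => //= r T [IH1 IH2]; split.
- case=> r1 r2 /IH1 h [_|i] /=; last exact: h.
  by split=> //; rewrite nth0.
- move=> h; split; [exact: (h 0 isT).1 | by have := (h 0 isT).2; rewrite /= nth0 |].
  by apply: IH2 => i hi; apply: (h i.+1).
Qed.

(** The common effect of [ins] and [addcell] on shapes, by which the two tableaux keep the same
    shape. *)
Fixpoint addsh (l : seq nat) (j : nat) : seq nat :=
  match l, j with
  | [::], _ => [:: 1]
  | a :: l', 0 => a.+1 :: l'
  | a :: l', j'.+1 => a :: addsh l' j'
  end.

Lemma ins_shape P x : map size (ins P x).1 = addsh (map size P) (ins P x).2.
Proof.
elim: P x => //= r P IH x; case: ifPn => //= h; last by rewrite size_rcons.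
rewrite IH size_rins; congr (_ :: _).
by apply/maxn_idPr; apply: find_has.
Qed.

Lemma ins_size P x : (ins P x).2 <= size P.
Proof. by elim: P x => //= r P IH x; case: ifPn => //= _; apply: IH. Qed.

Lemma ins_flatten P x : perm_eq (flatten (ins P x).1) (x :: flatten P).
Proof.
elim: P x => //= r P IH x; case: ifPn => /= h; last first.
  by rewrite cat_rcons perm_catC /= perm_cons perm_catC.
set i := find _ _; set y := nth 0 r i.
have hi : i < size r by apply: find_has.
apply: (perm_trans (y := rins r x ++ (y :: flatten P))).
  by rewrite perm_cat2l IH.
rewrite /rins -/i set_nthE hi -{3}(cat_take_drop i r) (drop_nth 0 hi) -/y.
apply/seq.permP => p; rewrite /= !count_cat /=.
by rewrite -!addnA addnCA [in RHS](addnCA (p y)).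
Qed.

(** Since [lt] may be reflexive at some letters, it is not a strict order. Mixed transitivity
    replaces the order axioms, with [~~ lt b a] read as [a] being allowed before [b] in a row. *)
Hypothesis lt_tr : transitive lt.
Hypothesis le_lt : forall a b c, ~~ lt b a -> lt b c -> lt a c.
Hypothesis lt_le : forall a b c, lt a b -> ~~ lt c b -> lt a c.

Lemma rins_ok r x : rowok r -> rowok (rins r x).
Proof.
move=> hr i j hij; rewrite size_rins !nth_rins => hj.
have fs := find_size (lt x) r.
have [ej|nj] := eqVneq j (find (lt x) r).
  rewrite -ej ltn_eqF //.
  by apply: nlt_find; rewrite -ej.
have [ei|ni] := eqVneq i (find (lt x) r); last by apply: hr => //; lia.
have hj' : j < size r by lia.
have hh : has (lt x) r by rewrite has_find; lia.
apply/negP => h; have := hr _ _ hij hj'; rewrite ei.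
by rewrite (lt_tr h (lt_find hh)).
Qed.

(** The bumped letter [y] lands weakly to the left of its old column [f]: if the row below reaches
    column [f], its entry there can be bumped by [y]. *)
Lemma colok_rins r s x : rowok r -> colok r s -> has (lt x) r ->
  colok (rins r x) (rins s (nth 0 r (find (lt x) r))).
Proof.
move=> hr [hs hd] hh; set f := find _ r; set y := nth 0 r f.
have hf : f < size r by apply: find_has.
have fs := find_size (lt y) s.
have hxy : lt x y by apply: lt_find.
have hff : find (lt y) s <= f.
  rewrite leqNgt; apply/negP => h.
  have := nlt_find h; rewrite hd //.
  by apply: leq_trans h _; apply: find_size.
split; first by rewrite !size_rins -/f; lia.
move=> j; rewrite size_rins !nth_rins -/f => hj.
have [ej|nj] := eqVneq j f; have [ej'|nj'] := eqVneq j (find (lt y) s) => //.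
- by apply: lt_tr hxy _; rewrite /y -ej; apply: hd; lia.
- apply: le_lt hxy; apply: nlt_find; rewrite -/f; lia.
- apply: hd; lia.
Qed.

Lemma colok_rcons r s x : colok r s -> colok (rcons r x) s.
Proof.
move=> [hs hd]; split; first by rewrite size_rcons; lia.
by move=> j hj; rewrite nth_rcons ifT; [apply: hd | lia].
Qed.

Lemma tabok_ins P x : tabok P -> tabok (ins P x).1.
Proof.
elim: P x => [|r P IH] x /=.
  by move=> _; split=> // i j; rewrite /=; case: j.
case=> hr hd hP; case: ifPn => hh /=.
  split; [exact: rins_ok | rewrite head_ins; exact: colok_rins | exact: IH].
split=> //; last exact: colok_rcons.
by rewrite -rins_rcons //; apply: rins_ok.
Qed.

(** If the second bump took place further right, [x2] would already stand in [r1] to the right of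
    the common bumped letter, which [x2] bumps; the row condition on [r1] forbids this. *)
Lemma rins_find_inj r1 r2 x1 x2 : rowok r1 ->
  has (lt x1) r1 -> has (lt x2) r2 -> rins r1 x1 = rins r2 x2 ->
  nth 0 r1 (find (lt x1) r1) = nth 0 r2 (find (lt x2) r2) ->
  find (lt x2) r2 <= find (lt x1) r1.
Proof.
move=> ok1 h1 h2 er ey; rewrite leqNgt; apply/negP => hlt.
have := congr1 size er; rewrite !size_rins => esz.
have := find_has h1; have := find_has h2 => s2 s1.
have := congr1 (nth 0 ^~ (find (lt x2) r2)) er; rewrite !nth_rins eqxx.
rewrite ifF; last by lia.
move=> e2; have := ok1 _ _ hlt; rewrite e2 ey lt_find //.
by move=> h; have : false by apply: h; lia.
Qed.

Lemma rins_inj r1 r2 x1 x2 : rowok r1 -> rowok r2 ->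
  has (lt x1) r1 -> has (lt x2) r2 -> rins r1 x1 = rins r2 x2 ->
  nth 0 r1 (find (lt x1) r1) = nth 0 r2 (find (lt x2) r2) ->
  r1 = r2 /\ x1 = x2.
Proof.
move=> ok1 ok2 h1 h2 er ey.
have ef : find (lt x1) r1 = find (lt x2) r2.
  apply/eqP; rewrite eqn_leq; apply/andP; split.
    exact: (rins_find_inj (r1 := r2)).
  exact: (rins_find_inj (r1 := r1)).
have e j := congr1 (nth 0 ^~ j) er.
have s1 := find_has h1; have s2 := find_has h2.
split; last by have := e (find (lt x1) r1); rewrite !nth_rins -ef eqxx.
apply: (@eq_from_nth _ 0).
  by have := congr1 size er; rewrite !size_rins; lia.
move=> j _; have [->|nj] := eqVneq j (find (lt x1) r1); first by rewrite {2}ef.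
by have := e j; rewrite !nth_rins -ef (negPf nj).
Qed.

(** The row index tells whether the first row bumped or grew. After a bump, induction on the lower
    rows recovers the bumped letter, and [rins_inj] then recovers the row. Empty rows are excluded
    since filling one looks like opening a new row. *)
Lemma ins_inj P1 P2 x1 x2 : tabok P1 -> tabok P2 ->
  [::] \notin P1 -> [::] \notin P2 -> ins P1 x1 = ins P2 x2 ->
  P1 = P2 /\ x1 = x2.
Proof.
elim: P1 P2 x1 x2 => [|r1 P1 IH] [|r2 P2] x1 x2 //=.
- by move=> _ _ _ _ [->].
- move=> _ _ _; rewrite in_cons negb_or => /andP [nr _].
  case: ifPn => // _ [] e _; case: r2 nr e => // a r2 _ /=.
  by case=> _; case: r2.
- move=> _ _; rewrite in_cons negb_or => /andP [nr _] _.
  case: ifPn => // _ [] e _; case: r1 nr e => // a r1 _ /=.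
  by case=> _; case: r1.
move=> [ok1 d1 t1] [ok2 d2 t2]; rewrite !in_cons !negb_or.
move=> /andP[_ n1] /andP[_ n2].
case: ifPn => h1; case: ifPn => h2 //= [].
- move=> er e1 e2.
  have ei : ins P1 (nth 0 r1 (find (lt x1) r1)) = ins P2 (nth 0 r2 (find (lt x2) r2)).
    by rewrite [LHS]surjective_pairing [RHS]surjective_pairing e1 e2.
  have [eP ey] := IH _ _ _ t1 t2 n1 n2 ei.
  by have [-> ->] := rins_inj ok1 ok2 h1 h2 er ey; rewrite eP.
- by move=> /rcons_inj [-> ->] ->.
Qed.

(** Reverse insertion: the last letter of row [j] is taken out and sent upwards, and each row above
    exchanges it for the last entry that bumps it. *)
Lemma ins_surj P mu j : tabok P -> map size P = addsh mu j ->
  sorted geq mu -> all (fun a => 0 < a) mu -> j <= size mu ->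
  exists P' x, [/\ ins P' x = (P, j), tabok P' & map size P' = mu].
Proof.
elim: P mu j => [|r P IH] [|a mu] [|j] //=.
- case=> _ _ _; case: r => // x r /= [/size0nil ->] /(congr1 size).
  by rewrite size_map => /size0nil -> _ _ _; exists [::], x.
- case=> okr d okP [] sr sP srt /andP[a0 pos] _.
  exists (take a r :: P), (nth 0 r a); split=> /=; last first.
  + by rewrite size_take sr ltnSn sP.
  + have sz : size (take a r) = a by rewrite size_take sr ltnSn.
    have hmu : size (head [::] P) <= a.
      by case: (P) sP srt => [|s P'] //= <- /= /andP[].
    split=> //.
      move=> i k hik; rewrite sz => hk; rewrite !nth_take //; last by lia.
      by apply: okr; lia.
    case: d => _ d; split; first by rewrite sz.
    by move=> k hk; rewrite nth_take; [exact: d | lia].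
  + have /negPf -> : ~~ has (lt (nth 0 r a)) (take a r).
      apply/negP => /(has_nthP 0) [i]; rewrite size_take sr ltnSn => hi.
      by rewrite nth_take //; apply/negP; apply: okr; rewrite ?sr.
    by rewrite -take_nth ?sr // -sr take_size.
- case=> okr d okP [] sr sP /path_sorted srt /andP[a0 pos] hj.
  have [P' [x [e ok' sh']]] := IH _ _ okP sP srt pos hj.
  have eh : head [::] P = rins (head [::] P') x by rewrite -head_ins e.
  set s := head [::] P' in eh; have oks : rowok s.
    by rewrite /s; case: (P') ok' => [|s' ?] //= [].
  set f := find (lt x) s.
  case: d => ds dl; rewrite eh size_rins -/f in ds dl.
  (* After the insertion below, [x] stands at column [f] of the next row, so the column condition
     supplies at least one candidate in [r]. *)
  have hfx : lt (nth 0 r f) x.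
    have := dl f; rewrite nth_rins eqxx; apply; lia.
  (* [i] is the last index of [r] whose entry may be bumped up by [x] *)
  have [i [hi hix hin]] : exists i, [/\ f <= i < size r, lt (nth 0 r i) x &
      forall c, i < c -> c < size r -> ~~ lt (nth 0 r c) x].
    have ex : exists i, (f <= i < size r) && lt (nth 0 r i) x.
      by exists f; rewrite hfx; lia.
    have bd i : (f <= i < size r) && lt (nth 0 r i) x -> i <= size r by lia.
    case: (ex_maxnP ex bd) => i /andP[h1 h2] h3; exists i; split=> // c hc1 hc2.
    by apply/negP => h; have := h3 c; rewrite h; lia.
  set z := nth 0 r i in hix; set r1 := set_nth 0 r i x.
  have nr1 c : nth 0 r1 c = if c == i then x else nth 0 r c.
    by rewrite nth_set_nth.
  have sr1 : size r1 = size r by rewrite size_set_nth; lia.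
  have fz : find (lt z) r1 = i.
    case: (findP (lt z) r1) => [nh|c hc hz hb].
      by case/negP: nh; apply/(has_nthP 0); exists i; rewrite ?nr1 ?eqxx ?sr1 //; lia.
    apply/eqP; rewrite eqn_leq; apply/andP; split; rewrite leqNgt; apply/negP => h.
      by have := hb 0 i h; rewrite nr1 eqxx hix.
    have := hz 0; rewrite nr1 ifF; last by lia.
    by apply/negP; apply: okr => //; lia.
  have hz : has (lt z) r1 by rewrite has_find fz sr1; lia.
  exists (r1 :: P'), z; split=> /=; last by rewrite sr1 sr sh'.
    rewrite hz fz nr1 eqxx e /rins fz /r1; congr ((_ :: _, _)).
    rewrite set_set_nth eqxx; apply: (@eq_from_nth _ 0).
      by rewrite size_set_nth; lia.
    by move=> c _; rewrite nth_set_nth /=; case: eqP => [->|].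
  split=> //.
    move=> b c hbc; rewrite sr1 !nr1 => hc.
    have [ec|nc] := eqVneq c i.
      have -> : b == i = false by lia.
      have hle : ~~ lt z (nth 0 r b) by apply: okr; lia.
      by apply/negP => h; move: hle; rewrite (lt_tr hix h).
    have [eb|nb] := eqVneq b i; first by apply: hin; lia.
    exact: okr.
  split; first by rewrite -/s; lia.
  move=> c; rewrite -/s nr1 => hc.
  have hs : f <= c -> lt x (nth 0 s c).
    move=> hfc; have hh : has (lt x) s by rewrite has_find -/f; lia.
    have h1 := lt_find hh; rewrite -/f in h1.
    move: hfc; rewrite leq_eqVlt => /orP[/eqP <- //|hfc].
    by apply: lt_le h1 _; apply: oks.
  have [ec|nc] := eqVneq c i; first by apply: hs; lia.
  have hd : c != f -> lt (nth 0 r c) (nth 0 s c).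
    by move=> ncf; have := dl c; rewrite nth_rins (negPf ncf); apply; lia.
  (* At column [f] the given row below holds [x] instead of the old entry, so the comparison passes
     through [x]. *)
  have [ec|/hd //] := eqVneq c f.
  apply: lt_tr (hs _); last by lia.
  have hci : c < i by lia.
  by rewrite ec.
Qed.

End Insertion.

(** * The correspondence and its inverse *)

Lemma iota1S n : iota 1 n.+1 = rcons (iota 1 n) n.+1.
Proof. by rewrite -{1}[n.+1]addn1 iotaD cats1 add1n. Qed.

Lemma tabok_sorted lt T : tabok lt T -> sorted geq (map size T).
Proof.
elim: T => //= r [|s T] IH [_ [/= h _] ok] //=.
by rewrite h; apply: IH.
Qed.

Lemma all_pos_nonnil (T : seq (seq nat)) :
  all (fun a => 0 < a) (map size T) = ([::] \notin T).
Proof.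
elim: T => //= r T ->; rewrite in_cons negb_or; congr (_ && _).
by case: r.
Qed.

(** * Growing and shrinking the recording tableau *)

Lemma addcell_cons0 r Q t : addcell (r :: Q) 0 t = rcons r t :: Q.
Proof. by []. Qed.

Lemma addcell_consS r Q j t : addcell (r :: Q) j.+1 t = r :: addcell Q j t.
Proof. by rewrite /addcell /= ltnS; case: ifP. Qed.

Lemma addcell_nil j t : addcell [::] j t = [:: [:: t]].
Proof. by []. Qed.

Lemma addcell_shape Q j t :
  map size (addcell Q j t) = addsh (map size Q) j.
Proof.
elim: Q j => [|r Q IH] [|j] //; first by rewrite addcell_cons0 /= size_rcons.
by rewrite addcell_consS /= IH.
Qed.

Lemma addcell_flatten Q j t :
  perm_eq (flatten (addcell Q j t)) (t :: flatten Q).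
Proof.
elim: Q j => [|r Q IH] [|j] //.
  by rewrite addcell_cons0 /= cat_rcons perm_catC /= perm_cons perm_catC.
rewrite addcell_consS /= (perm_trans (y := r ++ t :: flatten Q)) //.
  by rewrite perm_cat2l.
by rewrite perm_catC /= perm_cons perm_catC.
Qed.

Lemma addcell_nonnil Q j t : [::] \notin Q -> [::] \notin addcell Q j t.
Proof.
elim: Q j => [|r Q IH] [|j] //.
  by rewrite addcell_cons0 !in_cons !negb_or => /andP[_ ->]; case: r.
by rewrite addcell_consS !in_cons !negb_or => /andP[-> /IH ->].
Qed.

Lemma ins_nonnil lt P x : [::] \notin P -> [::] \notin (ins lt P x).1.
Proof.
elim: P x => [|r P IH] x //=.
rewrite in_cons negb_or => /andP[nr nP]; case: ifPn => h /=.
  rewrite in_cons negb_or IH // andbT.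
  by apply/eqP => /(congr1 size) /=; rewrite size_rins; lia.
by rewrite in_cons negb_or nP andbT; case: (r).
Qed.

Lemma addcell_neq0 Q j t : addcell Q j t <> [::].
Proof. by case: Q j => [|r Q] [|j]; rewrite // addcell_consS. Qed.

(** The fresh label [t] marks the added cell. The bounds on [j1] and [j2] matter because every index
    past the end opens the same new row. *)
Lemma addcell_inj Q1 Q2 j1 j2 t : t \notin flatten Q1 -> t \notin flatten Q2 ->
  [::] \notin Q1 -> [::] \notin Q2 -> j1 <= size Q1 -> j2 <= size Q2 ->
  addcell Q1 j1 t = addcell Q2 j2 t -> Q1 = Q2 /\ j1 = j2.
Proof.
elim: Q1 Q2 j1 j2 => [|r1 Q1 IH] [|r2 Q2] [|j1] [|j2] //=;
  rewrite ?addcell_nil ?addcell_cons0 ?addcell_consS.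
- move=> _ _ _; rewrite in_cons negb_or => /andP[nr _] _ _ [].
  by case: r2 nr => // a [|b r2].
- by move=> _ _ _ _ _ _ [_] /esym/addcell_neq0.
- move=> _ _; rewrite in_cons negb_or => /andP[nr _] _ _ _ [].
  by case: r1 nr => // a [|b r1].
- by move=> _ _ _ _ _ _ [_] /addcell_neq0.
- by move=> _ _ _ _ _ _ [] /rcons_inj [-> ->].
- rewrite !mem_cat !negb_or => _ /andP[h _] _ _ _ _ [] e.
  by rewrite -e mem_rcons mem_head in h.
- rewrite !mem_cat !negb_or => /andP[h _] _ _ _ _ _ [] e.
  by rewrite e mem_rcons mem_head in h.
rewrite !mem_cat !in_cons !negb_or => /andP[_ t1] /andP[_ t2] /andP[_ n1].
move=> /andP[_ n2]; rewrite !ltnS => h1 h2 [-> e].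
by have [-> ->] := IH _ _ _ t1 t2 n1 n2 h1 h2 e.
Qed.

(** A label larger than all others can violate only the shape condition. *)
Lemma tabok_addcell Q j t : tabok ltn Q -> all (fun a => a < t) (flatten Q) ->
  sorted geq (map size (addcell Q j t)) -> tabok ltn (addcell Q j t).
Proof.
elim: Q j => [|r Q IH] [|j].
- by move=> _ _ _; split=> //; case=> [|i] [|k].
- by move=> _ _ _; split=> //; case=> [|i] [|k].
- rewrite addcell_cons0 /= => -[okr d okQ]; rewrite all_cat => /andP[ar _] _.
  split=> //; last exact: colok_rcons.
  move=> i k hik; rewrite size_rcons ltnS => hk; rewrite !nth_rcons.
  have hi : i < size r by lia.
  rewrite hi; case: ltngtP hk => // hk _; first exact: okr.
  by rewrite /= -leqNgt ltnW //; apply: (allP ar); apply: mem_nth.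
rewrite addcell_consS /= => -[okr d okQ]; rewrite all_cat => /andP[ar aQ] srt.
split=> //; last by apply: IH => //; apply: path_sorted srt.
have hs : size (head [::] (addcell Q j t)) <= size r.
  by case: (addcell _ _ _) srt => //= ? ? /andP[].
clear srt; case: d => ds dl.
case: Q {IH okQ aQ} ds dl j hs => [|s Q] ds dl [|j] hs //=.
- by rewrite addcell_nil in hs *; split=> // [] [|k] //= _;
    apply: (allP ar); apply: mem_nth.
- by rewrite addcell_nil in hs *; split=> // [] [|k] //= _;
    apply: (allP ar); apply: mem_nth.
- rewrite addcell_cons0 /= size_rcons in hs *; split; first by rewrite size_rcons.
  move=> k; rewrite size_rcons ltnS => hk; rewrite nth_rcons.
  case: ltngtP hk => // hk _; first exact: dl.
  by apply: (allP ar); apply: mem_nth; rewrite hk.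
- by rewrite addcell_consS; split.
Qed.

(** A maximal entry ends the first row that contains it, and nothing lies below that end because
    columns increase strictly; it is a removable corner. *)
Lemma addcell_surj Q t : tabok ltn Q -> [::] \notin Q -> t \in flatten Q ->
  all (fun a => a <= t) (flatten Q) ->
  exists Q' j, [/\ Q = addcell Q' j t, j <= size Q', tabok ltn Q' &
                   [::] \notin Q'].
Proof.
elim: Q => //= r Q IH [okr d okQ]; rewrite in_cons negb_or => /andP[nr nQ].
rewrite mem_cat all_cat => + /andP[ar aQ].
have [tr _|ntr /= tQ] := boolP (t \in r); last first.
  have [Q' [j [e hj ok' n']]] := IH okQ nQ tQ aQ.
  exists (r :: Q'), j.+1; rewrite addcell_consS e; split=> //=; last first.
    by rewrite in_cons negb_or nr.
  split=> //; case: d; rewrite e.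
  case: (Q') hj ok' {n' e IH} => [|s Q''] hj ok' //=.
  case: (j) => [|j']; rewrite ?addcell_cons0 ?addcell_consS //= size_rcons.
  move=> h1 h2; split; first exact: ltnW.
  by move=> k hk; have := h2 k; rewrite nth_rcons hk; apply; lia.
case/lastP: r okr d nr ar tr => // r a okr [ds dl] _ ar tr.
have ea : a = t.
  apply/eqP; rewrite eqn_leq (allP ar) ?mem_rcons ?mem_head //=.
  have [i hi <-] := nthP 0 tr; rewrite size_rcons ltnS in hi.
  move: hi; rewrite leq_eqVlt => /orP[/eqP ->|hi].
    by rewrite nth_rcons ltnn eqxx.
  have := okr _ _ hi; rewrite size_rcons ltnSn => /(_ isT).
  by rewrite (nth_rcons _ _ _ (size r)) ltnn eqxx /= -leqNgt.
have {}ds : size (head [::] Q) <= size r.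
  rewrite leqNgt; apply/negP => h; have := dl _ h.
  rewrite nth_rcons ltnn eqxx ea /= ltnNge (allP aQ) //.
  case: (Q) h => //= s Q'' h; rewrite mem_cat mem_nth //.
(* If the corner was the whole row, no row lies below, and the cell is obtained by opening a new
   row. *)
have [er|nr] := eqVneq r [::].
  exists [::], 0; split=> //.
  rewrite er ea; case: (Q) nQ ds => // s Q''; rewrite er /= leqn0 size_eq0.
  by rewrite in_cons negb_or eq_sym => /andP[/negPf ->].
exists (r :: Q), 0; rewrite addcell_cons0 ea; split=> //=; last first.
  by rewrite in_cons negb_or eq_sym nr.
split=> //.
  move=> i k hik hk; have := okr _ _ hik; rewrite size_rcons !nth_rcons hk.
  by have -> : i < size r by [lia]; apply; lia.
split=> // k hk; have := dl _ hk; rewrite nth_rcons.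
by have -> : k < size r by lia.
Qed.

Lemma size_nth_map (T : seq (seq nat)) i :
  size (nth [::] T i) = nth 0 (map size T) i.
Proof. by elim: T i => [|r T IH] [|i] //=. Qed.

Lemma nth_sorted_geq s i : sorted geq s -> nth 0 s i.+1 <= nth 0 s i.
Proof.
move=> srt; have [h|h] := ltnP i.+1 (size s); last by rewrite nth_default.
exact: (sortedP 0 srt).
Qed.

(** * Standard tableaux as tableaux for the relation [ltn] *)

Lemma SYT_tabok lam Q : is_part lam -> is_SYT lam Q ->
  [/\ map size Q = lam, tabok ltn Q, [::] \notin Q &
      perm_eq (flatten Q) (iota 1 (sumn lam))].
Proof.
case/andP=> srt pos /and4P[/eqP sh /allP rows /allP cols pe]; split=> //.
  apply/tabok_nth => i hi; split.
    move=> a b hab hb; rewrite /= -leqNgt; apply: ltnW.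
    apply: (sorted_ltn_nth ltn_trans) => //; last by rewrite inE; lia.
    exact/rows/mem_nth.
  split; first by rewrite !size_nth_map -/(tab_shape Q) sh; apply: nth_sorted_geq.
  move=> j hj; have := cols i; rewrite mem_iota => /(_ hi)/allP; apply.
  by rewrite mem_iota.
by rewrite -all_pos_nonnil -/(tab_shape Q) sh.
Qed.

(** [tabok ltn] makes rows only weakly increasing; strictness comes from the entries being
    distinct. *)
Lemma tabok_SYT lam Q : map size Q = lam -> tabok ltn Q ->
  perm_eq (flatten Q) (iota 1 (sumn lam)) -> is_SYT lam Q.
Proof.
move=> sh ok pe; apply/and4P; split=> //; first exact/eqP.
- have un : uniq (flatten Q) by rewrite (perm_uniq pe) iota_uniq.
  elim: Q {sh pe} ok un => //= r Q IH [okr _ okQ].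
  rewrite cat_uniq => /and3P[ur _ /(IH okQ) ->]; rewrite andbT.
  rewrite ltn_sorted_uniq_leq ur /=.
  apply/(sortedP 0) => i hi; rewrite leqNgt; exact: okr.
apply/allP => i; rewrite mem_iota /= add0n => hi.
apply/allP => j; rewrite mem_iota /= add0n => hj.
have [_ [_ h]] := (tabok_nth _ _).1 ok i hi; exact: h.
Qed.

(** * The insertion correspondence for an arbitrary bumping relation *)

Section Correspondence.
Variable lt : rel nat.

Definition gRSK (w : seq nat) : seq (seq nat) * seq (seq nat) :=
  foldl (fun PQ (tx : nat * nat) =>
           let res := ins lt PQ.1 tx.2 in
           (res.1, addcell PQ.2 res.2 tx.1))
        ([::], [::]) (zip (iota 1 (size w)) w).

Lemma gRSK_rcons w x : gRSK (rcons w x) =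
  let res := ins lt (gRSK w).1 x in
  (res.1, addcell (gRSK w).2 res.2 (size w).+1).
Proof.
rewrite /gRSK size_rcons -{1}[(size w).+1]addn1 iotaD /= -cats1 zip_cat ?size_iota //=.
by rewrite foldl_cat.
Qed.

Lemma gRSK_flattenP w : perm_eq (flatten (gRSK w).1) w.
Proof.
elim/last_ind: w => // w x IH; rewrite gRSK_rcons /=.
apply: (perm_trans (ins_flatten _ _ _)).
by rewrite perm_sym perm_rcons perm_cons perm_sym.
Qed.

Lemma gRSK_flattenQ w : perm_eq (flatten (gRSK w).2) (iota 1 (size w)).
Proof.
elim/last_ind: w => // w x IH; rewrite gRSK_rcons /=.
apply: (perm_trans (addcell_flatten _ _ _)).
rewrite size_rcons iota1S perm_sym perm_rcons perm_cons.
by rewrite perm_sym.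
Qed.

Lemma gRSK_shape w : map size (gRSK w).1 = map size (gRSK w).2.
Proof.
elim/last_ind: w => // w x IH; rewrite gRSK_rcons /=.
by rewrite ins_shape addcell_shape IH.
Qed.

Lemma gRSK_nonnil w : [::] \notin (gRSK w).1 /\ [::] \notin (gRSK w).2.
Proof.
elim/last_ind: w => // w x [h1 h2]; rewrite gRSK_rcons /=.
by split; [apply: ins_nonnil | apply: addcell_nonnil].
Qed.

Lemma gRSK_ins_size w x : (ins lt (gRSK w).1 x).2 <= size (gRSK w).2.
Proof.
apply: leq_trans (ins_size _ _ _) _.
by rewrite -(size_map size (gRSK w).1) gRSK_shape size_map.
Qed.

Hypothesis lt_tr : transitive lt.
Hypothesis le_lt : forall a b c, ~~ lt b a -> lt b c -> lt a c.
Hypothesis lt_le : forall a b c, lt a b -> ~~ lt c b -> lt a c.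

Lemma gRSK_tabok w : tabok lt (gRSK w).1.
Proof.
elim/last_ind: w => // w x IH; rewrite gRSK_rcons /=.
exact: tabok_ins.
Qed.

(** That the grown shape is a partition is read off the insertion tableau, which has the same
    shape. *)
Lemma gRSK_tabokQ w : tabok ltn (gRSK w).2.
Proof.
elim/last_ind: w => // w x IH.
have := tabok_sorted (gRSK_tabok (rcons w x)); rewrite gRSK_shape.
rewrite gRSK_rcons /=; apply: tabok_addcell => //.
by apply/allP => a; rewrite (perm_mem (gRSK_flattenQ w)) mem_iota; lia.
Qed.

(** The last step can be undone: the largest label gives the row where insertion ended, and
    [ins_inj] gives back the earlier tableau and the letter. *)
Lemma gRSK_inj w1 w2 : size w1 = size w2 -> gRSK w1 = gRSK w2 -> w1 = w2.
Proof.
elim/last_ind: w1 w2 => [|w1 x1 IH] w2.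
  by move=> /esym/size0nil ->.
case/lastP: w2 => [|w2 x2]; rewrite !size_rcons // => -[esz].
rewrite !gRSK_rcons /= => -[eP]; rewrite esz => eQ.
have nt w : (size w).+1 \notin flatten (gRSK w).2.
  by rewrite (perm_mem (gRSK_flattenQ w)) mem_iota; lia.
have [eQ' ej] : (gRSK w1).2 = (gRSK w2).2 /\
    (ins lt (gRSK w1).1 x1).2 = (ins lt (gRSK w2).1 x2).2.
  apply: addcell_inj eQ; rewrite ?gRSK_ins_size ?nt ?(gRSK_nonnil _).2 //.
  by rewrite -esz nt.
have ei : ins lt (gRSK w1).1 x1 = ins lt (gRSK w2).1 x2.
  by rewrite [LHS]surjective_pairing [RHS]surjective_pairing eP ej.
have [eP' ->] := ins_inj (gRSK_tabok w1) (gRSK_tabok w2)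
  (gRSK_nonnil w1).1 (gRSK_nonnil w2).1 ei.
congr (rcons _ _); apply: IH => //.
by rewrite [LHS]surjective_pairing [RHS]surjective_pairing eP' eQ'.
Qed.

(** The cell of the largest label in [Q] says where reverse insertion into [T] starts; the letter it
    expels is the last letter of the word. *)
Lemma gRSK_surj n T Q : tabok ltn Q -> [::] \notin Q ->
  perm_eq (flatten Q) (iota 1 n) -> tabok lt T -> map size T = map size Q ->
  exists w, gRSK w = (T, Q).
Proof.
elim: n T Q => [|n IH] T Q okQ nQ pe okT sh.
  have eQ : Q = [::].
    case: (Q) nQ pe => // r Q'; rewrite in_cons negb_or => /andP[nr _].
    by move/perm_size; case: (r) nr.
  by exists [::]; rewrite eQ in sh *; case: (T) sh.
have mQ a : (a \in flatten Q) = (0 < a <= n.+1).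
  by rewrite (perm_mem pe) mem_iota; lia.
have [||Q' [j [eQ hj ok' n']]] := addcell_surj (t := n.+1) okQ nQ.
- by rewrite mQ; lia.
- by apply/allP => a; rewrite mQ; lia.
have [|||| T' [x [ei okT' shT']]] :=
  ins_surj lt_tr lt_le (P := T) (mu := map size Q') (j := j) okT.
- by rewrite sh eQ addcell_shape.
- exact: tabok_sorted ok'.
- by rewrite all_pos_nonnil.
- by rewrite size_map.
have pe' : perm_eq (flatten Q') (iota 1 n).
  move: pe; rewrite eQ => pe; have := addcell_flatten Q' j n.+1.
  rewrite perm_sym => /perm_trans /(_ pe); rewrite iota1S.
  by rewrite perm_sym perm_rcons perm_cons perm_sym.
have [w ew] := IH T' Q' ok' n' pe' okT' shT'.
exists (rcons w x); rewrite gRSK_rcons ew /= ei /= eQ.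
have -> : size w = n; last by [].
have := perm_size pe'; rewrite size_iota => <-.
by have := perm_size (gRSK_flattenQ w); rewrite ew size_iota.
Qed.

End Correspondence.

Lemma RSK_gRSK w : RSK w = gRSK ltn w.
Proof. by []. Qed.

(** * Standardization *)

Lemma rins_map (f : nat -> nat) lt r x :
  rins lt (map f r) (f x) = map f (rins (relpre f lt) r x).
Proof.
have fm : find (lt (f x)) (map f r) = find (relpre f lt x) r by rewrite find_map.
apply: (@eq_from_nth _ 0); first by rewrite size_map !size_rins size_map fm.
move=> i; rewrite size_rins size_map fm => hi.
rewrite [RHS](nth_map 0) ?size_rins // !nth_rins fm.
case: eqP => // ni; rewrite (nth_map 0) //.
by have := find_size (relpre f lt x) r; lia.
Qed.

Lemma ins_map (f : nat -> nat) lt P x :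
  ins lt (map (map f) P) (f x) =
  (map (map f) (ins (relpre f lt) P x).1, (ins (relpre f lt) P x).2).
Proof.
elim: P x => //= r P IH x.
have -> : has (lt (f x)) (map f r) = has (relpre f lt x) r by rewrite has_map.
case: ifPn => h /=; last by rewrite map_rcons.
have -> : find (lt (f x)) (map f r) = find (relpre f lt x) r by rewrite find_map.
by rewrite rins_map (nth_map 0) ?IH // -has_find.
Qed.

(** Writing a word as the image of its positions moves the letters into the relation. Two words of
    equal length thus become one word of positions under two relations. *)
Lemma gRSK_map (f : nat -> nat) lt w :
  gRSK lt (map f w) =
  (map (map f) (gRSK (relpre f lt) w).1, (gRSK (relpre f lt) w).2).
Proof.
elim/last_ind: w => // w x IH.
by rewrite map_rcons !gRSK_rcons IH /= ins_map /= size_map.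
Qed.

Section Agreement.
Variables lt1 lt2 : rel nat.
Hypothesis tr1 : transitive lt1.
Hypothesis tr2 : transitive lt2.
Hypothesis le_lt1 : forall a b c, ~~ lt1 b a -> lt1 b c -> lt1 a c.
Hypothesis le_lt2 : forall a b c, ~~ lt2 b a -> lt2 b c -> lt2 a c.

Definition agree a b := lt1 a b == lt2 a b.

(* The two relations need not agree within a row read from left to right,
   nor from a lower row to a higher one, but those comparisons never happen. *)
Fixpoint coherent (P : seq (seq nat)) : Prop :=
  match P with
  | [::] => True
  | r :: P' =>
      [/\ rowok lt1 r,
          forall i j, i < j -> j < size r -> agree (nth 0 r j) (nth 0 r i),
          forall a b, a \in r -> b \in flatten P' -> agree a b
        & coherent P']
  end.

Lemma mem_rins lt r x a : a \in rins lt r x ->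
  a = x \/ exists2 i, i < size r /\ i != find (lt x) r & a = nth 0 r i.
Proof.
move/(nthP 0) => [i]; rewrite size_rins nth_rins => hi.
case: eqP => [_ <-|/eqP ni <-]; [by left | right; exists i => //].
by split=> //; have := find_size (lt x) r; lia.
Qed.

(** An inserted letter is compared only with entries of the row it enters, and a bumped one only
    with lower rows. Coherence makes these comparisons agree, and it survives the insertion. *)
Lemma ins_agree P x : coherent P -> (forall z, z \in flatten P -> agree x z) ->
  ins lt1 P x = ins lt2 P x /\ coherent (ins lt1 P x).1.
Proof.
elim: P x => [|r P IH] x /=.
  by move=> _ _; split=> //; split=> // [] [|i] [|j].
case=> ok agr agP cP agx.
have agxr z : z \in r -> lt1 x z = lt2 x z.
  by move=> hz; apply/eqP/agx; rewrite mem_cat hz.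
have eh : has (lt1 x) r = has (lt2 x) r by apply: eq_in_has.
have ef : find (lt1 x) r = find (lt2 x) r by apply: eq_in_find.
have okr := rins_ok tr1 (x := x) ok.
have agr1 : forall i j, i < j -> j < size (rins lt1 r x) ->
    agree (nth 0 (rins lt1 r x) j) (nth 0 (rins lt1 r x) i).
  move=> i j hij; rewrite size_rins !nth_rins => hj.
  have fs := find_size (lt1 x) r.
  have [ej|nj] := eqVneq j (find (lt1 x) r).
    have -> : (i == find (lt1 x) r) = false by rewrite -ej ltn_eqF.
    apply/agx; rewrite mem_cat mem_nth //.
    by apply: leq_trans hij _; rewrite ej.
  have [ei|ni] := eqVneq i (find (lt1 x) r); last by apply: agr => //; lia.
  have hj' : j < size r by lia.
  have hh : has (lt1 x) r by rewrite has_find; lia.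
  have hh2 : has (lt2 x) r by rewrite -eh.
  (* Under both relations a later entry cannot bump [x]: by transitivity it would bump the old entry
     at that place, against the row condition. *)
  have := agr _ _ hij hj'; have := ok _ _ hij hj'; rewrite ei.
  rewrite /agree => /negPf -> /eqP/esym/negbT n2.
  have n1 := ok _ _ hij hj'; rewrite ei in n1.
  have -> : lt1 (nth 0 r j) x = false.
    by apply/negP => h; rewrite (tr1 h (lt_find hh)) in n1.
  have -> // : lt2 (nth 0 r j) x = false.
  apply/negP => h; move: n2; rewrite ef.
  by rewrite (tr2 h (lt_find hh2)).
rewrite -eh -ef; case: ifPn => hh; last first.
  split=> //=; rewrite -(rins_rcons hh); split=> // a b.
  rewrite rins_rcons // mem_rcons in_cons => /orP[/eqP ->|ha] hb; last exact: agP.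
  by apply: agx; rewrite mem_cat hb orbT.
set y := nth 0 r _.
have yr : y \in r by rewrite mem_nth // find_has.
have xy1 : lt1 x y by apply: lt_find.
have xy2 : lt2 x y by rewrite -agxr.
have [e c] : ins lt1 P y = ins lt2 P y /\ coherent (ins lt1 P y).1.
  by apply: IH => // z; apply: agP.
rewrite -e; split=> /=.
  by rewrite /rins ef.
split=> // a b /mem_rins ha; rewrite (perm_mem (ins_flatten _ _ _)) in_cons.
case: ha => [->|[i [hi ni] ->]] /orP[/eqP ->|hb].
- by rewrite /agree xy1 xy2.
- by apply: agx; rewrite mem_cat hb orbT.
(* Now [y] belongs to the lower rows. Entries left of its old place come weakly before [x], hence
   bump [y] under both relations; entries to the right agreed with it already. *)
- case: (ltngtP i (find (lt1 x) r)) ni => // [h|h] _; last exact: agr.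
  rewrite /agree (le_lt1 (nlt_find h) xy1) (le_lt2 _ xy2) //.
  by rewrite -agxr ?mem_nth //; apply: nlt_find h.
- by apply: agP => //; apply: mem_nth.
Qed.

Lemma gRSK_agree w : pairwise (fun a b => agree b a) w ->
  gRSK lt1 w = gRSK lt2 w /\ coherent (gRSK lt1 w).1.
Proof.
elim/last_ind: w => // w x IH; rewrite pairwise_rcons => /andP[/allP ax /IH[e c]].
rewrite !gRSK_rcons /= -e.
have [|-> c'] := ins_agree (x := x) c; last by [].
by move=> z; rewrite (perm_mem (gRSK_flattenP _ _)) => /ax.
Qed.

End Agreement.

(** * Strip expansions of the determinant *)

Section Strips.
Variables (l N : nat).
Implicit Types (lam : seq nat) (d : {ffun 'I_l -> 'I_N}).

Definition cut lam d : seq nat := [seq nth 0 lam (i : 'I_l) - d i | i <- enum 'I_l].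

(** Even [m] asks for a horizontal strip, odd [m] for a vertical one. Interlacing already makes the
    cut shape a partition; the vertical case has to demand it. *)
Definition strip (m : nat) lam d : bool :=
  [forall i : 'I_l, (d i <= nth 0 lam i) &&
     (if odd m then (d i <= 1) && (nth 0 (cut lam d) i.+1 <= nth 0 (cut lam d) i)
      else nth 0 lam i.+1 <= nth 0 (cut lam d) i)].

Lemma size_cut lam d : size (cut lam d) = l.
Proof. by rewrite size_map size_enum_ord. Qed.

Lemma nth_cut lam d (i : 'I_l) : nth 0 (cut lam d) i = nth 0 lam i - d i.
Proof. by rewrite (nth_map i) ?size_enum_ord // nth_ord_enum. Qed.

End Strips.

Local Open Scope ring_scope.

(** Multilinearity of the determinant in its rows, with [d] recording the term chosen in each
    row. *)
Lemma det_sum_rows (R : comNzRingType) l N (c : 'I_l -> 'I_N -> R)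
    (v : 'I_l -> 'I_N -> 'I_l -> R) :
  \det (\matrix_(i < l, j < l) \sum_(e < N) c i e * v i e j) =
  \sum_(d : {ffun 'I_l -> 'I_N})
    (\prod_i c i (d i)) * \det (\matrix_(i < l, j < l) v i (d i) j).
Proof.
rewrite /determinant; under eq_bigr => s _.
  under eq_bigr => i _ do rewrite mxE.
  rewrite bigA_distr_bigA mulr_sumr; over.
rewrite exchange_big /=; apply: eq_bigr => d _.
rewrite mulr_sumr; apply: eq_bigr => s _.
rewrite big_split /= mulrCA; congr (_ * (_ * _)).
by apply: eq_bigr => i _; rewrite mxE.
Qed.

(** * Jacobi-Trudi determinants and their recursion on the number of letters *)

Section SuperSchur.
Variables (R : fieldType) (z : nat -> R).

(* The coefficients of the product of the factors [1/(1 - z_m t)] for even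
   [m] and [1 + z_m t] for odd [m]. *)
Fixpoint qc (m r : nat) : R :=
  if m is m'.+1 then
    if odd m' then qc m' r + z m' * (if r is r'.+1 then qc m' r' else 0)
    else \sum_(i < r.+1) z m' ^+ i * qc m' (r - i)%N
  else (r == 0%N)%:R.

Definition qcz (m : nat) (t : int) : R := if t is Posz r then qc m r else 0.

Definition super_schur (m l : nat) (lam : seq nat) : R :=
  \det (\matrix_(i < l, j < l) qcz m ((nth 0%N lam i)%:Z - i%:Z + j%:Z)).

Lemma qcz_neg m t : t < 0 -> qcz m t = 0.
Proof. by case: t. Qed.

Lemma qcz_odd m t : odd m -> qcz m.+1 t = qcz m t + z m * qcz m (t - 1).
Proof.
move=> om; case: t => [[|r]|r].
- by rewrite /= om.
- have -> : Posz r.+1 - 1 = Posz r by lia.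
  by rewrite /= om.
- by rewrite !qcz_neg ?mulr0 ?addr0 //; lia.
Qed.

Lemma qcz_even m t : ~~ odd m ->
  qcz m.+1 t = qcz m t + z m * qcz m.+1 (t - 1).
Proof.
move=> /negPf om; case: t => [[|r]|r].
- by rewrite /= om big_ord1 expr0 mul1r /= mulr0 addr0.
- have -> : Posz r.+1 - 1 = Posz r by lia.
  rewrite /= om big_ord_recl expr0 mul1r subn0 mulr_sumr; congr (_ + _).
  by apply: eq_bigr => i _; rewrite lift0 exprS mulrA subSS.
- by rewrite !qcz_neg ?mulr0 ?addr0 //; lia.
Qed.

(** A truncated geometric expansion with its remainder kept, so that a row operation can cancel the
    remainder. *)
Lemma qcz_even_iter m t n : ~~ odd m ->
  qcz m.+1 t = \sum_(i < n) z m ^+ i * qcz m (t - i%:Z)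
               + z m ^+ n * qcz m.+1 (t - n%:Z).
Proof.
move=> om; elim: n => [|n ->]; first by rewrite big_ord0 subr0; ring.
rewrite big_ord_recr /= (qcz_even (t - n%:Z)) //.
have -> : t - n%:Z - 1 = t - n.+1%:Z by lia.
by rewrite exprS; ring.
Qed.

Section Expansion.
Variables (l N : nat) (lam : seq nat).
Hypothesis srt : sorted geq lam.
Hypothesis slam : size lam = l.
Hypothesis ltN : all (fun a => (a < N)%N) lam.
Hypothesis N1 : (1 < N)%N.

Let lamN i : (nth 0%N lam i < N)%N.
Proof.
have [h|h] := ltnP i (size lam); first exact/(allP ltN)/mem_nth.
by rewrite nth_default //; lia.
Qed.

Lemma det_not_strip m (d : {ffun 'I_l -> 'I_N}) : odd m ->
  (forall i, d i <= 1)%N -> ~~ strip m lam d ->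
  \det (\matrix_(i < l, j < l)
          qcz m ((nth 0%N lam i)%:Z - i%:Z + j%:Z - (d i)%:Z)) = 0.
Proof.
move=> om d1 ns.
(* Signed row lengths after removal, set to 0 below the last row. If they decrease weakly, they are
   nonnegative and [d] is a strip. *)
pose b k : int := if insub k is Some i then (nth 0%N lam k)%:Z - (d i)%:Z else 0.
have bE (i : 'I_l) : b i = (nth 0%N lam i)%:Z - (d i)%:Z by rewrite /b valK.
have b0 : b l = 0 by rewrite /b insubF // ltnn.
have [/forallP hb|] := boolP [forall i : 'I_l, b i.+1 <= b i].
  have bpos k : (k <= l)%N -> 0 <= b (l - k)%N.
    elim: k => [|k IH] hk; first by rewrite subn0 b0.
    have hlt : (l - k.+1 < l)%N by lia.
    apply: le_trans (IH _) _; first by lia.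
    have := hb (Ordinal hlt); rewrite /=.
    by have -> : (l - k.+1).+1 = (l - k)%N by lia.
  have dle (i : 'I_l) : (d i <= nth 0%N lam i)%N.
    have := bpos (l - i)%N; rewrite subKn ?(ltnW (ltn_ord i)) // bE => h.
    have := h (leq_subr _ _); lia.
  case/negP: ns; apply/forallP => i; rewrite om dle d1 /=.
  rewrite nth_cut; have := hb i; rewrite bE.
  have [hi|hi] := ltnP i.+1 l; last first.
    by rewrite (@nth_default _ _ (cut lam d)) ?size_cut.
  rewrite (bE (Ordinal hi)) (nth_cut _ _ (Ordinal hi)) /=.
  by have := dle i; have := dle (Ordinal hi); rewrite /=; lia.
move=> /forallPn [i]; rewrite -ltNge bE.
have d1i := d1 i; have hle := nth_sorted_geq i srt.
have [hi|hi] := ltnP i.+1 l.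
  rewrite (bE (Ordinal hi)) /= => hlt.
  (* Here the two parts are equal, [d] is 1 on row [i] and 0 on the next one, and the two rows of
     the matrix coincide. *)
  apply: (determinant_alternate (i1 := i) (i2 := Ordinal hi)).
    by rewrite -val_eqE /=; lia.
  move=> j; rewrite !mxE /=; congr qcz.
  have := d1 (Ordinal hi); lia.
have ei : i.+1 = l by have := ltn_ord i; lia.
rewrite ei b0 => hlt.
(* The last row has signed length -1, so all its indices are at most -1 and the row is zero. *)
rewrite (expand_det_row _ i) big1 // => j _; rewrite mxE qcz_neg ?mul0r //.
have := ltn_ord j; lia.
Qed.

Lemma super_schur_odd m : odd m ->
  super_schur m.+1 l lam =
  \sum_(d : {ffun 'I_l -> 'I_N} | strip m lam d)
     (\prod_i z m ^+ d i) * super_schur m l (cut lam d).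
Proof.
move=> om; rewrite /super_schur.
(* Zero coefficients beyond 1 pad the two terms of [1 + z t] to a sum over ['I_N]. *)
pose c (i : 'I_l) (e : 'I_N) : R := if (e <= 1)%N then z m ^+ e else 0.
pose v (i : 'I_l) (e : 'I_N) (j : 'I_l) : R :=
  qcz m ((nth 0%N lam i)%:Z - i%:Z + j%:Z - e%:Z).
transitivity (\det (\matrix_(i < l, j < l) \sum_(e < N) c i e * v i e j)).
  congr (\det _); apply/matrixP => i j; rewrite !mxE qcz_odd //.
  rewrite (bigD1 (Ordinal (ltnW N1))) // (bigD1 (Ordinal N1)) //= /c /v /=.
  rewrite big1 ?addr0 ?subr0 ?expr0 ?mul1r ?expr1 //.
  move=> e /andP[]; rewrite -!val_eqE /= => e0 e1.
  by rewrite ifF ?mul0r //; lia.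
rewrite det_sum_rows [LHS](bigID (strip m lam)) /= [X in _ + X]big1 ?addr0.
  apply: eq_bigr => d /forallP sd; congr (_ * _).
    by apply: eq_bigr => i _; have := sd i; rewrite om /c => /and3P[_ ->].
  congr (\det _); apply/matrixP => i j; rewrite !mxE /v; congr qcz.
  by rewrite nth_cut; have /andP[h _] := sd i; lia.
move=> d ns; have [/forallP d1|] := boolP [forall i, d i <= 1]%N.
  by rewrite det_not_strip ?mulr0.
move=> /forallPn [i hi]; rewrite (bigD1 i) //= /c (negPf hi) !mul0r //.
Qed.

Lemma super_schur_even m : ~~ odd m ->
  super_schur m.+1 l lam =
  \sum_(d : {ffun 'I_l -> 'I_N} | strip m lam d)
     (\prod_i z m ^+ d i) * super_schur m l (cut lam d).
Proof.
move=> om; rewrite /super_schur.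
(* The largest number of cells that a horizontal strip can take from row [i]. *)
pose D (i : 'I_l) := (nth 0 lam i - nth 0 lam i.+1)%N.
have hD (i : 'I_l) : (D i < N)%N by have := lamN i; rewrite /D; lia.
pose c (i : 'I_l) (e : 'I_N) : R := if (e <= D i)%N then z m ^+ e else 0.
pose v (i : 'I_l) (e : 'I_N) (j : 'I_l) : R :=
  qcz m ((nth 0%N lam i)%:Z - i%:Z + j%:Z - e%:Z).
set M := \matrix_(i, j) qcz m.+1 _.
pose U : 'M[R]_l :=
  \matrix_(i, j) ((i == j)%:R - (if j == i.+1 :> nat then z m ^+ (D i).+1 else 0)).
have dU : \det U = 1.
  rewrite -det_tr det_trig; last first.
    apply/is_trig_mxP => i j hij; rewrite !mxE -val_eqE /=.
    by rewrite !ifF ?subr0; [rewrite gtn_eqF | lia..].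
  by rewrite big1 // => i _; rewrite !mxE eqxx ifF ?subr0 //; lia.
(* Subtracting [z^(D i + 1)] times the next row truncates the geometric
   expansion of row [i] to exactly the sizes allowed in a horizontal strip. *)
transitivity (\det (\matrix_(i < l, j < l) \sum_(e < N) c i e * v i e j)).
  rewrite -[LHS]mul1r -dU -det_mulmx; congr (\det _); apply/matrixP => i j.
  rewrite !mxE; under eq_bigr => k _ do rewrite !mxE mulrBl.
  rewrite big_split /= (bigD1 i) //= eqxx mul1r big1 ?addr0; last first.
    by move=> k /negPf nk; rewrite eq_sym nk mul0r.
  rewrite (qcz_even_iter _ (D i).+1 om).
  have -> : \sum_(i0 < l) - ((if i0 == i.+1 :> nat then z m ^+ (D i).+1 else 0)
      * qcz m.+1 ((nth 0%N lam i0)%:Z - i0%:Z + j%:Z)) =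
      - (z m ^+ (D i).+1 * qcz m.+1 ((nth 0%N lam i)%:Z - i%:Z + j%:Z - (D i).+1%:Z)).
    have hle := nth_sorted_geq i srt.
    (* Shifting row [i] by [D i + 1] gives the indices of row [i.+1]. For the last row the shifted
       index is [j - l], which is negative, so the remainder vanishes. *)
    have [hi|hi] := ltnP i.+1 l.
      rewrite (bigD1 (Ordinal hi)) //= eqxx big1 ?addr0; last first.
        by move=> k; rewrite -val_eqE /= => /negPf ->; rewrite mul0r oppr0.
      congr (- (_ * qcz _ _)); rewrite /D; lia.
    rewrite big1; last first.
      move=> k _; rewrite ifF ?mul0r ?oppr0 //; have := ltn_ord k; lia.
    rewrite qcz_neg ?mulr0 ?oppr0 //.
    have e0 : nth 0%N lam i.+1 = 0%N by rewrite nth_default // slam.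
    have := ltn_ord j; rewrite /D; lia.
  rewrite addrK (big_ord_widen N (fun e => z m ^+ e *
    qcz m ((nth 0%N lam i)%:Z - i%:Z + j%:Z - e%:Z))) // big_mkcond /=.
  apply: eq_bigr => e _; rewrite /c /v ltnS; case: ifP => // _; by rewrite mul0r.
(* A horizontal strip bounds each [d i] separately, so any other choice has a zero coefficient. *)
have sE (d : {ffun 'I_l -> 'I_N}) : strip m lam d = [forall i, d i <= D i]%N.
  apply: eq_forallb => i; rewrite (negPf om) nth_cut /D.
  have := nth_sorted_geq i srt; lia.
rewrite det_sum_rows [LHS](bigID (strip m lam)) /= [X in _ + X]big1 ?addr0.
  apply: eq_bigr => d; rewrite sE => /forallP sd; congr (_ * _).
    by apply: eq_bigr => i _; rewrite /c sd.
  congr (\det _); apply/matrixP => i j; rewrite !mxE /v; congr qcz.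
  by rewrite nth_cut; have := sd i; rewrite /D; lia.
move=> d; rewrite sE => /forallPn [i hi].
by rewrite (bigD1 i) //= /c (negPf hi) !mul0r.
Qed.

Lemma super_schur_rec m :
  super_schur m.+1 l lam =
  \sum_(d : {ffun 'I_l -> 'I_N} | strip m lam d)
     (\prod_i z m ^+ d i) * super_schur m l (cut lam d).
Proof.
by have [om|om] := boolP (odd m); [apply: super_schur_odd | apply: super_schur_even].
Qed.

End Expansion.

(** Without letters only index 0 contributes: the zero shape gives the identity matrix, and a
    positive first part gives a zero first row. *)
Lemma super_schur0 l lam : sorted geq lam -> size lam = l ->
  super_schur 0 l lam = (all (fun a => a == 0%N) lam)%:R.
Proof.
move=> srt sl; case: l sl => [|l] sl.
  by rewrite /super_schur det_mx00 (size0nil sl).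
have [h|h] := boolP (all _ _).
  have -> : super_schur 0 l.+1 lam = \det (1%:M : 'M[R]_l.+1).
    congr (\det _); apply/matrixP => i j; rewrite !mxE.
    have -> : nth 0%N lam i = 0%N.
      by apply/eqP/(allP h)/mem_nth; rewrite sl.
    rewrite sub0r; case: (ltngtP i j) => hij.
    - have -> : - i%:Z + j%:Z = (j - i)%N by lia.
      rewrite /= -val_eqE /=; congr (_%:R); lia.
    - by rewrite qcz_neg -?val_eqE /=; [rewrite gtn_eqF | lia].
    - have -> : - i%:Z + j%:Z = 0 by lia.
      by rewrite -val_eqE /= hij eqxx.
  by rewrite det1.
have h0 : (0 < nth 0%N lam 0)%N.
  rewrite lt0n; apply: contra h => /eqP e0; apply/allP => a.
  case/(nthP 0%N) => i hi <-; elim: i hi => [|i IH] hi; first by rewrite e0.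
  have /= /eqP h1 := IH (ltnW hi).
  by have := nth_sorted_geq i srt; rewrite h1 leqn0.
rewrite /super_schur (expand_det_row _ ord0) big1 // => j _.
rewrite mxE.
have -> : (nth 0%N lam (@ord0 l))%:Z - (@ord0 l)%:Z + j%:Z =
  (nth 0%N lam 0 + j)%N by rewrite /=; lia.
by rewrite /= addn_eq0 gtn_eqF //= mul0r.
Qed.

End SuperSchur.

(** * The coefficients [qcoef] as a two-step recursion per variable *)

Lemma coef_mul_linear (R : fieldType) (p : {poly R}) (c : R) r :
  (p * (1 + c *: 'X))`_r = p`_r + c * (if r is r'.+1 then p`_r' else 0).
Proof.
rewrite mulrDr mulr1 coefD -scalerAr coefZ coefMX; by case: r.
Qed.

Lemma coef_mul_geom (R : fieldType) (p : {poly R}) (c : R) r N : (r <= N)%N ->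
  (p * \sum_(m < N.+1) (c *: 'X) ^+ m)`_r =
  \sum_(i < r.+1) c ^+ i * p`_(r - i).
Proof.
move=> hr; rewrite coefMr; apply: eq_bigr => i _; rewrite mulrC; congr (_ * _).
have hi : (i < N.+1)%N by have := ltn_ord i; lia.
rewrite coef_sum (bigD1 (Ordinal hi)) //= exprZn coefZ coefXn eqxx mulr1.
rewrite big1 ?addr0 // => m; rewrite -val_eqE /= => /negPf nm.
by rewrite exprZn coefZ coefXn eq_sym nm mulr0.
Qed.

(** Variable [i] contributes a geometric factor at code [2i] and a linear one at [2i + 1]. Extending
    [Y] to all naturals allows induction on [k]. *)
Lemma qcoefE (R : fieldType) k (Y : nat -> R) r :
  qcoef (fun i : 'I_k => Y i) r = qc (fun a => Y a./2) k.*2 r.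
Proof.
(* The truncation degree is separated from [r], since the induction needs lower coefficients of the
   same product. *)
suff h N : (r <= N)%N -> (\prod_(i < k) ((1 + Y i *: 'X) *
    \sum_(m < N.+1) (Y i *: 'X) ^+ m))`_r = qc (fun a => Y a./2) k.*2 r.
  exact: h.
elim: k r => [|k IH] r hr.
  by rewrite big_ord0 coef1.
rewrite big_ord_recr doubleS /= (mulrC (1 + _)) mulrA coef_mul_linear.
rewrite odd_double /= uphalf_double half_double.
have h s : (s <= N)%N -> (\prod_(i < k) ((1 + Y i *: 'X) *
     \sum_(m < N.+1) (Y i *: 'X) ^+ m) * \sum_(m < N.+1) (Y k *: 'X) ^+ m)`_s =
     \sum_(i < s.+1) Y k ^+ i * qc (fun a => Y a./2) k.*2 (s - i)%N.
  move=> hs; rewrite coef_mul_geom //; apply: eq_bigr => i _.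
  by rewrite IH //; lia.
by rewrite h //; case: r hr => // r hr; rewrite h //; lia.
Qed.

Local Close Scope ring_scope.

(** * Super tableaux as chains of strips *)

(* [blt a b]: an inserted letter [a] bumps [b].  Even keys are the positive
   letters, which repeat along rows; odd keys repeat down columns. *)
Definition blt : rel nat := fun a b => (a < b) || (odd a && (a == b)).

Lemma blt_trans : transitive blt.
Proof.
move=> b a c; rewrite /blt => /orP[h1|/andP[o /eqP ->]] //.
case/orP=> [h2|/andP[_ /eqP <-]]; last by rewrite h1.
by rewrite (ltn_trans h1 h2).
Qed.

Lemma bge_blt_trans a b c : ~~ blt b a -> blt b c -> blt a c.
Proof.
rewrite /blt negb_or -leqNgt => /andP[h1 h2].
case/orP=> [h3|/andP[o /eqP e]]; first by rewrite (leq_ltn_trans h1 h3).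
by move: h2; rewrite o -e /= => h2; rewrite ltn_neqAle h1 eq_sym h2.
Qed.

Lemma blt_bge_trans a b c : blt a b -> ~~ blt c b -> blt a c.
Proof.
rewrite /blt negb_or -leqNgt => + /andP[h1 h2].
case/orP=> [h3|/andP[o /eqP e]]; first by rewrite (leq_trans h3 h1).
rewrite -e in h1 h2; move: h1; rewrite leq_eqVlt => /orP[/eqP ec|->] //.
by move: h2; rewrite -ec o eqxx.
Qed.

Lemma blt_leq a b : blt a b -> a <= b.
Proof. by case/orP=> [/ltnW|/andP[_ /eqP ->]]. Qed.

Lemma nblt_leq a b : ~~ blt b a -> a <= b.
Proof. by rewrite /blt negb_or -leqNgt => /andP[]. Qed.

(** Rows increase weakly, so the letters below [m] form an initial segment. *)
Lemma rowok_count r m j : rowok blt r -> j < size r ->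
  (nth 0 r j < m) = (j < count (fun a => a < m) r).
Proof.
elim: r j => // a r IH j okr hj /=.
have okr' : rowok blt r.
  by move=> i k hik hk; apply: (okr i.+1 k.+1).
have [am|am] := ltnP a m; first by case: j hj => [|j] //= hj; rewrite IH.
have ge b : b \in a :: r -> m <= b.
  case/(nthP 0) => -[|i] hi <- //; apply: leq_trans am _.
  by apply: nblt_leq; apply: (okr 0 i.+1).
rewrite ltnNge ge ?mem_nth //=.
have -> : count (fun b => b < m) r = 0 by [
  apply/eqP; rewrite eqn0Ngt -has_count; apply/hasPn => b hb;
  rewrite -leqNgt ge // in_cons hb orbT].
by rewrite ltn0.
Qed.

Lemma rowok_take lt r p : rowok lt r -> rowok lt (take p r).
Proof.
move=> ok i j hij; rewrite size_take => hj.
have [h1 h2] : j < p /\ j < size r by case: ifP hj; lia.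
by rewrite !nth_take ?(ltn_trans hij h1) //; apply: ok.
Qed.

Section Tableaux.
Variables l N : nat.

Definition extend (m : nat) (d : {ffun 'I_l -> 'I_N}) (T : seq (seq nat)) :=
  [seq nth [::] T (i : 'I_l) ++ nseq (d i) m | i <- enum 'I_l].

(** The outermost strip carries the largest letter [m']. All tableaux in a chain have [l] rows, some
    possibly empty, matching the fixed size of the determinant. *)
Fixpoint tabs (m : nat) (lam : seq nat) : seq (seq (seq nat)) :=
  if m is m'.+1 then
    [seq extend m' d T | d <- enum [pred d : {ffun 'I_l -> 'I_N} | strip m' lam d],
                         T <- tabs m' (cut lam d)]
  else if all (fun a => a == 0) lam then [:: nseq l [::]] else [::].

Lemma size_extend m d T : size (extend m d T) = l.
Proof. by rewrite size_map size_enum_ord. Qed.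

Lemma nth_extend m d T (i : 'I_l) :
  nth [::] (extend m d T) i = nth [::] T i ++ nseq (d i) m.
Proof. by rewrite (nth_map i) ?size_enum_ord // nth_ord_enum. Qed.

Lemma cut_sorted m lam (d : {ffun 'I_l -> 'I_N}) :
  strip m lam d -> sorted geq (cut lam d).
Proof.
move=> /forallP sd; apply/(sortedP 0) => i; rewrite size_cut => hi.
have hi' : i < l by apply: ltnW.
have /andP[_] := sd (Ordinal hi'); case: ifP => _; first by case/andP.
rewrite /= (nth_cut _ _ (Ordinal hi)) /=; lia.
Qed.

Lemma cut_ltN lam (d : {ffun 'I_l -> 'I_N}) : size lam = l ->
  all (fun a => a < N) lam -> all (fun a => a < N) (cut lam d).
Proof.
move=> sl /allP h; apply/allP => a /mapP [i _ ->].
apply: leq_ltn_trans (leq_subr _ _) _.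
by apply/h/mem_nth; rewrite sl.
Qed.


Lemma nth_map_ord (T : Type) (x0 : T) (f : 'I_l -> T) (i : 'I_l) :
  nth x0 [seq f j | j <- enum 'I_l] i = f i.
Proof. by rewrite (nth_map i) ?size_enum_ord // nth_ord_enum. Qed.

Lemma tabok_extend m lam (d : {ffun 'I_l -> 'I_N}) T :
  sorted geq lam -> strip m lam d -> map size T = cut lam d -> tabok blt T ->
  all (all (fun a => a < m)) T ->
  tabok blt (extend m d T) /\ all (all (fun a => a < m.+1)) (extend m d T).
Proof.
move=> srt /forallP sd sh /tabok_nth ok /allP lm.
have sT : size T = l by rewrite -(size_map size T) sh size_cut.
have szT (i : 'I_l) : size (nth [::] T i) = nth 0 lam i - d i.
  by rewrite size_nth_map sh nth_cut.
have nthm (i : 'I_l) j : j < size (nth [::] T i) -> nth 0 (nth [::] T i) j < m.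
  by move=> hj; apply: (allP (lm _ _)); apply: mem_nth; rewrite ?sT.
have entry (i : 'I_l) j : j < nth 0 lam i ->
    nth 0 (nth [::] T i ++ nseq (d i) m) j =
    if j < nth 0 lam i - d i then nth 0 (nth [::] T i) j else m.
  by move=> hj; rewrite nth_cat szT nth_nseq; case: ifPn => // h; rewrite ifT //; lia.
split; last first.
  apply/allP => r /mapP [i _ ->]; rewrite all_cat all_nseq ltnSn orbT andbT.
  apply/(all_nthP 0) => j hj; apply: leq_trans (nthm _ _ hj) _; lia.
apply/tabok_nth => i; rewrite size_extend => hi.
pose oi := Ordinal hi; rewrite -[i]/(val oi) nth_extend.
have /andP[di hd] := sd oi.
split.
  move=> a b hab; rewrite size_cat size_nseq szT subnK // => hb.
  rewrite !entry //; last by lia.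
  case: ifP => hbT.
    rewrite ifT; last by lia.
    by apply: (ok _ _).1 => //; rewrite ?sT ?szT.
  case: ifP => haT; rewrite /blt.
    have /nthm h : a < size (nth [::] T oi) by rewrite szT.
    by rewrite negb_or -leqNgt (ltnW h) negb_and orbC neq_ltn h orbT.
  (* Two copies of [m] in one row: an odd [m] occurs at most once there. *)
  rewrite ltnn eqxx andbT /=; case: ifP hd => // _ /andP[]; lia.
have [hi1|hi1] := ltnP i.+1 l; last first.
  by rewrite (@nth_default _ _ (extend _ _ _)) ?size_extend //.
pose oi1 := Ordinal hi1; rewrite -[(val oi).+1]/(val oi1) nth_extend.
have /andP[di1 _] := sd oi1.
have hcut : nth 0 lam oi1 - d oi1 <= nth 0 lam oi - d oi.
  case: ifP hd => _; first by rewrite -[(val oi).+1]/(val oi1) !nth_cut => /andP[].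
  by rewrite nth_cut => h; apply: leq_trans (leq_subr _ _) h.
have hlam : nth 0 lam oi1 <= nth 0 lam oi.
  exact: nth_sorted_geq.
split.
  by rewrite !size_cat !size_nseq !szT !subnK.
move=> j; rewrite size_cat size_nseq szT subnK // => hj.
rewrite !entry //; last by apply: leq_trans hlam.
have hiT : i < size T by rewrite sT.
have [_ [_ okd]] := ok _ hiT.
have [hj1|hj1] := ltnP j (nth 0 lam oi1 - d oi1).
  rewrite (leq_trans hj1 hcut).
  by apply: okd; rewrite -[(val oi).+1]/(val oi1) szT.
case: ifP => hj2.
  by rewrite /blt nthm // szT.
(* A copy of [m] above another is allowed for odd [m] and excluded by interlacing for even [m]. *)
rewrite /blt ltnn eqxx andbT /=.
case: (boolP (odd m)) hd => //= _; rewrite (nth_cut _ _ oi) => h.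
by have := leq_trans hj h; rewrite hj2.
Qed.

(** Deleting all copies of the largest letter leaves the first [p i] cells of row [i], and the
    tableau conditions make the deleted cells a strip. *)
Lemma tabok_split m lam T : map size T = lam -> size lam = l ->
  all (fun a => a < N) lam -> tabok blt T -> all (all (fun a => a < m.+1)) T ->
  exists (d : {ffun 'I_l -> 'I_N}) T',
    [/\ strip m lam d, T = extend m d T', map size T' = cut lam d, tabok blt T' &
        all (all (fun a => a < m)) T'].
Proof.
move=> sh sl /allP lN /tabok_nth ok /allP lm.
have sT : size T = l by rewrite -sl -sh size_map.
pose p i := count (fun a => a < m) (nth [::] T i).
have szT i : size (nth [::] T i) = nth 0 lam i by rewrite size_nth_map sh.
have ple i : p i <= nth 0 lam i by rewrite -szT count_size.
have dN (i : 'I_l) : nth 0 lam i - p i < N.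
  apply: leq_ltn_trans (leq_subr _ _) _; apply/lN/mem_nth; by rewrite sl.
pose d := [ffun i : 'I_l => Ordinal (dN i)].
have cutE i : i < l -> nth 0 (cut lam d) i = p i.
  move=> hi; rewrite (nth_cut _ _ (Ordinal hi)) ffunE /= subKn //.
have okr i : i < l -> rowok blt (nth [::] T i).
  by move=> hi; apply: (ok i _).1; rewrite sT.
have okd i : i < l -> colok blt (nth [::] T i) (nth [::] T i.+1).
  by move=> hi; apply: (ok i _).2; rewrite sT.
have cnt i j : i < l -> j < nth 0 lam i -> (nth 0 (nth [::] T i) j < m) = (j < p i).
  by move=> hi hj; apply: rowok_count; rewrite ?szT //; apply: okr.
have ltm i j : i < l -> j < nth 0 lam i -> nth 0 (nth [::] T i) j <= m.
  move=> hi hj; rewrite -ltnS; apply: (allP (lm _ _)); apply: mem_nth; rewrite ?sT //.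
  by rewrite szT.
have eqm i j : i < l -> j < nth 0 lam i -> p i <= j -> nth 0 (nth [::] T i) j = m.
  move=> hi hj hp; apply/eqP; rewrite eqn_leq ltm //= leqNgt cnt //; lia.
have pout i : l <= i -> p i = 0 by move=> hi; rewrite /p nth_default ?sT.
have lout i : l <= i -> nth 0 lam i = 0 by move=> hi; rewrite nth_default ?sl.
have lsrt i : i < l -> nth 0 lam i.+1 <= nth 0 lam i.
  by move=> hi; have [h _] := okd i hi; rewrite !szT in h.
(* An entry less than [m] at column [p i] of row [i.+1] would force such an entry above it. *)
have psrt i : i < l -> p i.+1 <= p i.
  move=> hi; have [hi1|hi1] := ltnP i.+1 l; last by rewrite pout.
  rewrite leqNgt; apply/negP => h; have hl := ple i.+1; have hs := lsrt i hi.
  have [_ /(_ (p i))] := okd i hi; rewrite szT => /(_ (leq_trans h hl)) /blt_leq h2.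
  have h3 : nth 0 (nth [::] T i.+1) (p i) < m by rewrite cnt //; lia.
  have := leq_ltn_trans h2 h3; rewrite cnt ?ltnn //; lia.
exists d, [seq take (p (i : 'I_l)) (nth [::] T i) | i <- enum 'I_l]; split.
- apply/forallP => i; have hi := ltn_ord i; rewrite ffunE /= leq_subr /= (cutE i) //.
  have ps : nth 0 (cut lam d) i.+1 = p i.+1.
    have [hi1|hi1] := ltnP i.+1 l; first by rewrite cutE.
    by rewrite pout // nth_default ?size_cut.
  rewrite ps; case: ifPn => om.
    (* Two removed cells in a row would be adjacent copies of an odd letter. *)
    rewrite psrt // andbT leqNgt; apply/negP => h.
    have := okr i hi (p i) (p i).+1 (ltnSn _); rewrite szT !eqm ?leqnn //; try lia.
    by rewrite /blt ltnn eqxx om /= => h'; have : false by apply: h'; lia.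
  (* A cell below the first removed cell of row [i] holds at most [m]; as [m] is even, the cell
     above it would hold less than [m]. *)
  rewrite leqNgt; apply/negP => h; have hs := lsrt i hi.
  have hi1 : i.+1 < l by rewrite ltnNge; apply/negP => h'; rewrite lout in h.
  have [_ /(_ (p i))] := okd i hi; rewrite szT => /(_ h) h2.
  have : nth 0 (nth [::] T i) (p i) < m; last by rewrite cnt ?ltnn //; lia.
  have h3 := ltm i.+1 (p i) hi1 h.
  case/orP: h2 => [h2|/andP[o /eqP h2]]; first by lia.
  rewrite ltn_neqAle h2 h3 andbT; apply/eqP => e; move: o; rewrite h2 e; exact/negP.
- apply: (@eq_from_nth _ [::]); first by rewrite size_extend.
  move=> i; rewrite sT => hi; rewrite -[i]/(val (Ordinal hi)) nth_extend.
  rewrite nth_map_ord ffunE /=; set r := nth [::] T i.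
  apply: (@eq_from_nth _ 0).
    rewrite size_cat size_nseq size_takel ?szT //; have := ple i; lia.
  move=> j; rewrite szT => hj; rewrite nth_cat size_takel ?szT // nth_nseq.
  case: ifPn => hjp; first by rewrite nth_take.
  by rewrite ifT ?eqm //; lia.
- apply: (@eq_from_nth _ 0); first by rewrite !size_map.
  move=> i; rewrite 2!size_map size_enum_ord => hi.
  rewrite -size_nth_map cutE // -[i]/(val (Ordinal hi)) nth_map_ord size_takel //=.
  by rewrite szT.
- apply/tabok_nth => i; rewrite size_map size_enum_ord => hi.
  rewrite -{1 2}[i]/(val (Ordinal hi)) nth_map_ord /=.
  split; first by apply: rowok_take; apply: okr.
  have [hi1|hi1] := ltnP i.+1 l; last first.
    rewrite (_ : nth _ _ i.+1 = [::]); first by split.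
    by rewrite nth_default // size_map size_enum_ord.
  rewrite -[i.+1]/(val (Ordinal hi1)) nth_map_ord /=.
  have pi := ple i; have pi1 := ple i.+1; have pp := psrt i hi.
  split; first by rewrite !size_takel ?szT.
  move=> j; rewrite size_takel ?szT // => hj; rewrite !nth_take //; try lia.
  by have [_] := okd i hi; apply; rewrite szT; lia.
- apply/allP => r /mapP [i _ ->]; apply/(all_nthP 0) => j.
  have hi := ltn_ord i; have pi := ple i.
  rewrite size_takel ?szT // => hj; rewrite nth_take // cnt //; lia.
Qed.

Lemma mem_tabs m lam T : sorted geq lam -> size lam = l ->
  all (fun a => a < N) lam ->
  T \in tabs m lam <->
  [/\ map size T = lam, tabok blt T & all (all (fun a => a < m)) T].
Proof.
elim: m lam T => [|m IH] lam T srt sl lN.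
  rewrite /=; case: ifPn => h; split.
  - rewrite inE => /eqP ->; split; last by rewrite all_nseq orbT.
    + by rewrite map_nseq /=; have /all_pred1P -> := h; rewrite sl.
    + apply/tabok_nth => i _; rewrite !nth_nseq !if_same; split=> //.
  - case=> sh _ /allP a0; rewrite inE -sl -sh size_map.
    apply/eqP/all_pred1P/allP => r /a0; case: r => //.
  - by [].
  - case=> sh _ /allP a0; case/negP: h; apply/allP => a; rewrite -sh.
    case/mapP=> r hr ->; have := a0 _ hr; case: r {hr} => //.
rewrite /=; split.
  case/allpairsPdep => d [T' []]; rewrite mem_enum inE => sd.
  have srt' := cut_sorted sd; have sl' := size_cut lam d.
  have lN' := cut_ltN d sl lN.
  case/(IH _ _ srt' sl' lN') => sh ok lm ->.
  have [ok' lm'] := tabok_extend srt sd sh ok lm; split=> //.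
  apply: (@eq_from_nth _ 0); first by rewrite size_map size_extend.
  move=> i; rewrite size_map size_extend => hi.
  rewrite -size_nth_map -[i]/(val (Ordinal hi)) nth_extend size_cat size_nseq.
  rewrite size_nth_map sh nth_cut subnK //.
  by have /forallP/(_ (Ordinal hi))/andP[] := sd.
case=> sh ok lm; have [d [T' [sd -> sh' ok' lm']]] := tabok_split sh sl lN ok lm.
apply/allpairsPdep; exists d, T'; split=> //; first by rewrite mem_enum.
by apply/IH; rewrite ?size_cut ?(cut_sorted sd) ?cut_ltN.
Qed.

(** In each row, filtering the letters below [m] recovers the tableau and counting [m] recovers
    [d]. *)
Lemma extend_inj m (d1 d2 : {ffun 'I_l -> 'I_N}) T1 T2 :
  size T1 = l -> size T2 = l ->
  all (all (fun a => a < m)) T1 -> all (all (fun a => a < m)) T2 ->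
  extend m d1 T1 = extend m d2 T2 -> d1 = d2 /\ T1 = T2.
Proof.
move=> s1 s2 /allP lm1 /allP lm2 e.
have split (T : seq (seq nat)) (d : {ffun 'I_l -> 'I_N}) (i : 'I_l) :
    size T = l -> {in T, forall r, all (fun a => a < m) r} ->
    let r := nth [::] (extend m d T) i in
    nth [::] T i = filter (fun a => a < m) r /\ (d i : nat) = count (pred1 m) r.
  move=> sT lm; have lmi := lm (nth [::] T i); rewrite mem_nth ?sT // in lmi.
  move: (lmi isT) => {lm}lmi /=; rewrite nth_extend filter_cat; split.
    rewrite (all_filterP lmi) -[RHS]/(_ ++ _).
    rewrite (_ : filter _ (nseq _ _) = [::]) ?cats0 //.
    by apply/eqP; rewrite -[_ == _]negbK -has_filter has_nseq ltnn andbF.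
  rewrite count_cat count_nseq /= eqxx mul1n.
  rewrite (_ : count _ _ = 0) //; apply/eqP; rewrite -leqn0 leqNgt -has_count.
  by apply/hasPn => a /(allP lmi) /= h; rewrite ltn_eqF.
split.
  apply/ffunP => i; apply: val_inj => /=.
  by rewrite (split T1 d1 i s1 lm1).2 (split T2 d2 i s2 lm2).2 e.
apply: (@eq_from_nth _ [::]); first by rewrite s1.
move=> i; rewrite s1 => hi; pose oi := Ordinal hi.
by rewrite -[i]/(val oi) (split T1 d1 oi s1 lm1).1 (split T2 d2 oi s2 lm2).1 e.
Qed.

Lemma tabs_uniq m lam : sorted geq lam -> size lam = l ->
  all (fun a => a < N) lam -> uniq (tabs m lam).
Proof.
elim: m lam => [|m IH] lam srt sl lN /=; first by case: ifP.
apply: allpairs_uniq_dep; first exact: enum_uniq.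
  move=> d; rewrite mem_enum inE => sd.
  by apply: IH; rewrite ?size_cut ?(cut_sorted sd) ?cut_ltN.
have memP (d : {ffun 'I_l -> 'I_N}) T : strip m lam d -> T \in tabs m (cut lam d) ->
    size T = l /\ all (all (fun a => a < m)) T.
  move=> sd /(mem_tabs m T (cut_sorted sd) (size_cut lam d) (cut_ltN d sl lN)).
  case=> sh _ lm.
  by split=> //; rewrite -(size_map size T) sh size_cut.
move=> p1 p2 /allpairsPdep [d1 [T1 [+ h1 ->]]] /allpairsPdep [d2 [T2 [+ h2 ->]]].
rewrite !mem_enum !inE => sd1 sd2 /= e.
have [sz1 lm1] := memP _ _ sd1 h1; have [sz2 lm2] := memP _ _ sd2 h2.
by have [-> ->] := extend_inj sz1 sz2 lm1 lm2 e.
Qed.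

Local Open Scope ring_scope.

(** Both sides satisfy the recursion that removes the strip of the largest letter. *)
Lemma sum_tabs (R : fieldType) (z : nat -> R) m lam : (1 < N)%N ->
  sorted geq lam -> size lam = l -> all (fun a => (a < N)%N) lam ->
  \sum_(T <- tabs m lam) \prod_(a <- flatten T) z a = super_schur z m l lam.
Proof.
move=> N1; elim: m lam => [|m IH] lam srt sl lN.
  rewrite super_schur0 //=; case: ifP => _; last by rewrite big_nil.
  rewrite big_seq1 (_ : flatten _ = [::]) ?big_nil //.
  by elim: (l) => //= l' ->.
rewrite (super_schur_rec z srt sl lN N1) /= big_allpairs_dep big_enum /=.
apply: eq_bigr => d sd.
rewrite -IH ?size_cut ?(cut_sorted sd) ?cut_ltN // mulr_sumr.
rewrite big_seq_cond [RHS]big_seq_cond; apply: eq_bigr => T /andP[hT _].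
have sT : size T = l.
  have [sh _ _] := (mem_tabs m T (cut_sorted sd) (size_cut lam d) (cut_ltN d sl lN)).1 hT.
  by rewrite -(size_map size T) sh size_cut.
rewrite !big_flatten /= big_map big_enum /=.
under eq_bigr => i _ do rewrite big_cat big_nseq iter_mulr_1 /=.
rewrite big_split /= mulrC; congr (_ * _).
by rewrite (big_nth [::]) sT big_mkord.
Qed.

End Tableaux.

Local Open Scope ring_scope.

(** * Shuffles *)

Lemma lkey_half k (a : letter k) : (lkey a)./2 = a.1.
Proof. by rewrite /lkey addnC mul2n half_bit_double. Qed.

Lemma odd_lkey k (a : letter k) : odd (lkey a) = a.2.
Proof. by rewrite /lkey oddD mul2n odd_double; case: a.2. Qed.

Lemma lkey_inj k : injective (@lkey k).
Proof.
move=> [a1 a2] [b1 b2] e; congr pair.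
  by apply: val_inj; rewrite /= -(lkey_half (a1, a2)) e lkey_half.
by rewrite -[a2](odd_lkey (a1, a2)) e odd_lkey.
Qed.

Lemma lkey_lt k (a : letter k) : (lkey a < k.*2)%N.
Proof. by case: a => [[a ha] b]; rewrite /lkey /=; lia. Qed.

Lemma lkey_surj k w : all (fun a => (a < k.*2)%N) w ->
  exists s : seq (letter k), map (@lkey k) s = w.
Proof.
elim: w => [|a w IH] /=; first by exists [::].
case/andP=> ha /IH [s es]; have ha2 : (a./2 < k)%N by lia.
exists ((Ordinal ha2, odd a) :: s); rewrite /= es /lkey /=; congr (_ :: _); lia.
Qed.

Section Shuffle.
Variables (k n : nat) (J : n.-tuple (letter k)).

Definition keys : seq nat := map (@lkey k) J.

Let less (p : 'I_n) := [set q : 'I_n | lkey (tnth J q) < lkey (tnth J p)]%N.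
Let same (p : 'I_n) := if (tnth J p).2
  then [set q : 'I_n | (p <= q)%N && (tnth J q == tnth J p)]
  else [set q : 'I_n | (q <= p)%N && (tnth J q == tnth J p)].

Lemma nth_shuffle_perm (p : 'I_n) :
  nth 0%N (shuffle_perm J) p = (#|less p| + #|same p|)%N.
Proof. by rewrite nth_map_ord /same; case: ifP. Qed.

Lemma nth_keys (p : 'I_n) : nth 0%N keys p = lkey (tnth J p).
Proof. by rewrite (nth_map (tnth J p)) ?size_tuple // -tnth_nth. Qed.

(** The disjoint sets [less p] and [same p] both lie in [less q], and [same q] contains [q]. *)
Lemma shuffle_perm_lt (p q : 'I_n) : (lkey (tnth J p) < lkey (tnth J q))%N ->
  (#|less p| + #|same p| < #|less q| + #|same q|)%N.
Proof.
move=> h.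
have sameP r : same r \subset [set t | tnth J t == tnth J r].
  by apply/subsetP => t; rewrite /same; case: ifP; rewrite !inE => _ /andP[].
have -> : (#|less p| + #|same p|)%N = #|less p :|: same p|.
  rewrite cardsU (_ : less p :&: same p = set0) ?cards0 ?subn0 //.
  apply/setP => t; rewrite !inE; apply/negP => /andP[h1].
  by move/(subsetP (sameP p)); rewrite inE => /eqP e; rewrite e ltnn in h1.
have hq : (0 < #|same q|)%N.
  by apply/card_gt0P; exists q; rewrite /same; case: ifP; rewrite inE leqnn eqxx.
apply: leq_ltn_trans (subset_leq_card (_ : _ \subset less q)) _; last by lia.
apply/subsetP => t; rewrite !inE => /orP[h1|]; first by lia.
by move/(subsetP (sameP p)); rewrite inE => /eqP ->.
Qed.

(** Insertion compares later entries with earlier ones only. At equal letters the values decrease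
    for negative letters and increase for positive ones, which is the tie rule of [blt]. *)
Lemma shuffle_perm_agree (p q : 'I_n) : (p < q)%N ->
  (nth 0 (shuffle_perm J) q < nth 0 (shuffle_perm J) p)%N =
  blt (nth 0%N keys q) (nth 0%N keys p).
Proof.
move=> hpq; rewrite !nth_shuffle_perm !nth_keys /blt.
case: (ltngtP (lkey (tnth J q)) (lkey (tnth J p))) => h /=.
- exact: shuffle_perm_lt.
- by rewrite andbF; apply/negbTE; rewrite -leqNgt ltnW // shuffle_perm_lt.
have e := lkey_inj h; rewrite andbT odd_lkey.
have -> : less q = less p by rewrite /less e.
rewrite ltn_add2l /same e; case: ifP => _.
  apply: proper_card; apply/properP; split.
    by apply/subsetP => t; rewrite !inE => /andP[h1 ->]; rewrite andbT; lia.
  by exists p; rewrite inE ?leqnn ?eqxx // leqNgt hpq.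
apply/negbTE; rewrite -leqNgt; apply: subset_leq_card.
by apply/subsetP => t; rewrite !inE => /andP[h1 ->]; rewrite andbT; lia.
Qed.

Lemma RSK_rec_shuffle : RSK_rec (shuffle_perm J) = (gRSK blt keys).2.
Proof.
(* Both words are images of the list of positions, so the two pulled-back relations can be compared
   there. *)
have e1 : shuffle_perm J = map (nth 0 (shuffle_perm J))%N (iota 0 n).
  have sz : size (shuffle_perm J) = n by rewrite size_map size_enum_ord.
  by have := mkseq_nth 0%N (shuffle_perm J); rewrite /mkseq sz.
have e2 : keys = map (nth 0 keys)%N (iota 0 n).
  by have := mkseq_nth 0%N keys; rewrite /mkseq size_map size_tuple.
rewrite /RSK_rec RSK_gRSK e1 e2 !gRSK_map /=; congr _.2.
apply: (gRSK_agree _ _ _ _ _).1.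
- by move=> a b c; apply: ltn_trans.
- by move=> a b c; apply: blt_trans.
- by move=> a b c; rewrite /= -leqNgt; apply: leq_ltn_trans.
- by move=> a b c; apply: bge_blt_trans.
apply/(pairwiseP 0%N) => i j; rewrite !inE size_iota => hi hj hij.
rewrite !nth_iota // !add0n /agree /=; apply/eqP.
exact: (@shuffle_perm_agree (Ordinal hi) (Ordinal hj)).
Qed.

End Shuffle.

(** * The probabilities *)

Section Probability.
Variables (R : fieldType) (k : nat) (y : 'I_k -> R).

(** The two signs of a letter share one weight; codes without a letter get the default 0. *)
Definition key_weight (a : nat) : R := if insub a./2 is Some i then y i else 0.

Lemma key_weight_lkey (a : letter k) : key_weight (lkey a) = y a.1.
Proof. by rewrite /key_weight lkey_half valK. Qed.

Lemma Slam_super_schur lam :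
  Slam y lam = super_schur key_weight k.*2 (size lam) lam.
Proof.
congr (\det _); apply/matrixP => i j; rewrite !mxE.
case: (_ + _) => // r; pose Y i : R := if insub i is Some j then y j else 0.
rewrite -[RHS]/(qc (fun a => Y a./2) k.*2 r) -qcoefE /= /qcoef.
by under [in RHS]eq_bigr => t _ do rewrite /Y valK.
Qed.

Lemma word_prob_keys n (J : n.-tuple (letter k)) :
  word_prob y J = (\prod_(a <- keys J) key_weight a) / 2 ^+ n.
Proof.
rewrite /word_prob prodf_div prodr_const card_ord; congr (_ / _).
rewrite big_map big_tuple; apply: eq_bigr => p _.
by rewrite key_weight_lkey.
Qed.

(** For fixed [Q], sending a word to its insertion tableau is a bijection onto [tabs]; it preserves
    content and hence weight. *)
Lemma sum_recording n lam Q : is_part lam -> sumn lam = n -> is_SYT lam Q ->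
  \sum_(J : n.-tuple (letter k) | RSK_rec (shuffle_perm J) == Q) word_prob y J
  = Slam y lam / 2 ^+ n.
Proof.
move=> hlam hn hQ; have [shQ okQ nQ pe] := SYT_tabok hlam hQ.
have [srt _] := andP hlam; rewrite hn in pe.
under eq_bigr => J _ do rewrite word_prob_keys.
rewrite -mulr_suml; congr (_ / _); rewrite Slam_super_schur.
(* The bound [n.+2] exceeds every part, and also exceeds 1 when [n] is 0. *)
have lN : all (fun a => (a < n.+2)%N) lam.
  apply/allP => a ha; rewrite ltnS -hn.
  by rewrite (perm_sumn (perm_to_rem ha)) /=; lia.
rewrite -(@sum_tabs (size lam) n.+2) //.
pose P (J : n.-tuple (letter k)) := (gRSK blt (keys J)).1.
transitivity (\sum_(T <- [seq P J | J <- enum [pred J : n.-tuple (letter k) |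
    RSK_rec (shuffle_perm J) == Q]]) \prod_(a <- flatten T) key_weight a).
  rewrite big_map big_enum /=; apply: eq_bigr => J _.
  by apply: perm_big; rewrite perm_sym; apply: gRSK_flattenP.
have szk (J : n.-tuple (letter k)) : size (keys J) = n by rewrite size_map size_tuple.
apply: perm_big; apply: uniq_perm.
- rewrite map_inj_in_uniq ?enum_uniq // => J1 J2.
  rewrite !mem_enum !inE !RSK_rec_shuffle => /eqP e1 /eqP e2 e.
  apply: val_inj; apply: (inj_map (@lkey_inj k)).
  apply: (gRSK_inj blt_trans bge_blt_trans).
    by rewrite !szk.
  by rewrite [LHS]surjective_pairing [RHS]surjective_pairing e1 e2 -/(P J1) e.
- exact: tabs_uniq.
move=> T; apply/mapP/idP.
  case=> J; rewrite mem_enum inE RSK_rec_shuffle => /eqP eJ ->.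
  apply/mem_tabs => //; split.
  - by rewrite gRSK_shape eJ.
  - exact: (gRSK_tabok blt_trans bge_blt_trans).
  - apply/allP => r hr; apply/allP => a ha.
    have : a \in flatten (P J) by apply/flattenP; exists r.
    rewrite (perm_mem (gRSK_flattenP _ _)) => /mapP [b _ ->].
    exact: lkey_lt.
move/mem_tabs => [|||shT okT lT] //.
(* Surjectivity: the preimage of the pair [(T, Q)] uses only codes of letters, since it has the
   content of [T]. *)
have [w ew] := gRSK_surj blt_trans blt_bge_trans okQ nQ pe okT (etrans shT (esym shQ)).
have wlt : all (fun a => (a < k.*2)%N) w.
  apply/allP => a; have := gRSK_flattenP blt w; rewrite ew => /perm_mem <-.
  by case/flattenP => r /(allP lT) /allP h /h.
have [s es] := lkey_surj wlt.
have ss : size s == n.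
  rewrite -(size_map (@lkey k)) es; apply/eqP.
  have := perm_size (gRSK_flattenQ blt w); rewrite ew size_iota => <-.
  by rewrite (perm_size pe) size_iota.
exists (Tuple ss); last by rewrite /P /keys /= es ew.
by rewrite mem_enum inE RSK_rec_shuffle /keys /= es ew.
Qed.

End Probability.

(** * Summing over the standard tableaux of a given shape *)

Lemma shuffle_rec_SYT k n (J : n.-tuple (letter k)) lam : sumn lam = n ->
  tab_shape (RSK_rec (shuffle_perm J)) = lam ->
  is_SYT lam (RSK_rec (shuffle_perm J)).
Proof.
rewrite RSK_rec_shuffle => hn sh; apply: tabok_SYT => //.
  exact: (gRSK_tabokQ blt_trans bge_blt_trans).
by have := gRSK_flattenQ blt (keys J); rewrite size_map size_tuple hn.
Qed.

Definition filling lam (s : 'S_(sumn lam)) : seq (seq nat) :=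
  reshape lam [seq (s i).+1 | i <- enum 'I_(sumn lam)].

Lemma filling_inj lam : injective (@filling lam).
Proof.
have fl (s : 'S_(sumn lam)) :
    flatten (filling s) = [seq (s i).+1 | i <- enum 'I_(sumn lam)].
  by rewrite reshapeKr // size_map size_enum_ord.
move=> s t /(congr1 flatten); rewrite !fl => e; apply/permP => i; apply: val_inj.
have := congr1 (fun u => nth 0%N u i) e.
by rewrite !nth_map_ord => -[].
Qed.

(** The row reading of [Q], shifted down by one, is an injective self-map of ['I_n] and thus a
    permutation. *)
Lemma filling_surj lam Q : is_SYT lam Q -> exists s, @filling lam s = Q.
Proof.
case/and4P=> /eqP sh _ _ pe; set n := sumn lam in pe *.
have sz : size (flatten Q) = n by rewrite (perm_size pe) size_iota.
have un : uniq (flatten Q) by rewrite (perm_uniq pe) iota_uniq.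
have rng i : (i < n)%N -> (0 < nth 0%N (flatten Q) i <= n)%N.
  move=> hi; have := mem_nth 0%N (s := flatten Q) (n := i).
  by rewrite sz (perm_mem pe) mem_iota add1n ltnS => /(_ hi).
have lt (i : 'I_n) : ((nth 0%N (flatten Q) i).-1 < n)%N by have := rng i (ltn_ord i); lia.
pose f (i : 'I_n) := Ordinal (lt i).
have fI : injective f.
  move=> i j /(congr1 val) /= e; apply: val_inj; apply/eqP.
  rewrite -(nth_uniq 0%N _ _ un) ?sz ?ltn_ord //; apply/eqP.
  have /andP[hi _] := rng i (ltn_ord i); have /andP[hj _] := rng j (ltn_ord j).
  by rewrite -(prednK hi) -(prednK hj) e.
pose s : 'S_n := perm fI; exists s; rewrite /filling.
have -> : [seq (s i).+1 | i <- enum 'I_(sumn lam)] = flatten Q.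
  apply: (@eq_from_nth _ 0%N); first by rewrite size_map size_enum_ord sz.
  move=> i; rewrite size_map size_enum_ord => hi.
  rewrite -[i]/(val (Ordinal hi)) nth_map_ord permE /=.
  by have /andP[h _] := rng i hi; rewrite prednK.
by rewrite -sh /tab_shape -/(shape Q) flattenK.
Qed.
Unset Implicit Arguments.

Theorem theorem5p4 (R : realFieldType) (k n : nat) (y : 'I_k -> R)
  (hy0 : forall i, 0 <= y i) (hy1 : \sum_(i < k) y i = 1)
  (lam : seq nat) (Q : seq (seq nat))
  (hlam : is_part lam) (hn : sumn lam = n) (hQ : is_SYT lam Q) :
  \sum_(J : n.-tuple (letter k) | RSK_rec (shuffle_perm J) == Q) word_prob y J
    = Slam y lam / 2 ^+ n
  /\
  \sum_(J : n.-tuple (letter k) | tab_shape (RSK_rec (shuffle_perm J)) == lam)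
      word_prob y J
    = (nSYT lam)%:R * Slam y lam / 2 ^+ n.
Proof.
split; first exact: sum_recording.
(* Words of shape [lam] are grouped by recording tableau; each such tableau is standard and is the
   filling of exactly one permutation. *)
transitivity (\sum_(s in [set s : 'S_(sumn lam) | is_SYT lam (filling s)])
    \sum_(J : n.-tuple (letter k) | RSK_rec (shuffle_perm J) == filling s)
      word_prob y J); last first.
  rewrite (eq_bigr (fun=> Slam y lam / 2 ^+ n)); last first.
    by move=> s; rewrite inE => hs; apply: sum_recording.
  by rewrite sumr_const -[RHS]mulrA mulr_natl.
under [RHS]eq_bigr => s _ do rewrite big_mkcond /=.
rewrite exchange_big big_mkcond /=; apply: eq_bigr => J _.
set QJ := RSK_rec _; case: eqP => sh; last first.
  rewrite big1 // => s; rewrite inE => /and4P[/eqP e _ _ _]; case: eqP => // eQ.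
  by case: sh; rewrite eQ.
have hJ := shuffle_rec_SYT hn sh; rewrite -/QJ in hJ.
have [s es] := filling_surj hJ.
rewrite (bigD1 s) /=; last by rewrite inE es.
rewrite es eqxx big1 ?addr0 // => t /andP[_ /eqP nt]; case: eqP => // et.
by case: nt; apply: (@filling_inj lam); rewrite es et.
Qed.
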